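(* Let $R$ be a commutative ring with $R=2R$ (i.e. $2$ is a unit of $R$), and let $I$ be an ideal of $R$. Let $(P,\langle\,,\rangle)$ be a locally split orthogonal $R$-module with $P$ of rank $2n$, $n\ge 2$, and let $Q=R^2\oplus P$ with the induced form of $\mathbb{H}(R)\oplus P$. Then $$\mathrm{Trans}_{\mathrm{O}}(Q,IQ,\langle\,,\rangle)=\mathrm{ETrans}_{\mathrm{O}}(Q,IQ,\langle\,,\rangle).$$
   Context: All rings are commutative with identity. An orthogonal $R$-module is a pair $(P,\langle\,,\rangle)$ where $P$ is a finitely generated projective $R$-module of even (constant) rank and $\langle\,,\rangle:P\times P\to R$ is a symmetric bilinear form that is non-degenerate (the induced map $P\to P^*=\mathrm{Hom}_R(P,R)$ is an isomorphism). An element $u\in P$ is unimodular if $\phi(u)=1$ for some $R$-linear $\phi:P\to R$. The hyperbolic plane $\mathbb{H}(R)$ is $R^2$ with form $\langle (a_1,b_1),(a_2,b_2)\rangle=a_1b_2+a_2b_1$; $Q=R^2\oplus P$ carries the orthogonal-sum form $\langle (a,b,p),(a',b',p')\rangle=ab'+a'b+\langle p,p'\rangle$. An orthogonal transvection of an orthogonal module $M$ is a map $\tau(m)=m-\langle u,m\rangle v+\langle v,m\rangle u$ where $u,v\in M$ satisfy $\langle u,u\rangle=\langle v,v\rangle=\langle u,v\rangle=0$ and at least one of $u,v$ is unimodular. For an ideal $I$, $\mathrm{Trans}_{\mathrm{O}}(M,IM,\langle\,,\rangle)$ is the group generated by the orthogonal transvections of $M$ for which $u\in IM$ or $v\in IM$.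 The elementary orthogonal transvections of $Q$ are, for $q\in P$ with $\langle q,q\rangle=0$, the maps $\rho(q):(a,b,p)\mapsto(a,\,b+\langle p,q\rangle,\,p-aq)$ and $\mu(q):(a,b,p)\mapsto(a+\langle p,q\rangle,\,b,\,p-bq)$; $\mathrm{ETrans}_{\mathrm{O}}(Q,\langle\,,\rangle)$ is the group they generate. $\mathrm{ETrans}_{\mathrm{O}}(IQ,\langle\,,\rangle)$ is the subgroup generated by $\rho(q),\mu(q)$ with $q\in IP$, and $\mathrm{ETrans}_{\mathrm{O}}(Q,IQ,\langle\,,\rangle)$ is its normal closure in $\mathrm{ETrans}_{\mathrm{O}}(Q,\langle\,,\rangle)$. An orthogonal module $(P,\langle\,,\rangle)$ is split if there is a direct summand $N\subseteq P$ with $N=N^\perp=\{p\in P:\langle p,x\rangle=0\ \forall x\in N\}$; it is locally split if $(P_{\mathfrak m},\langle\,,\rangle)$ is split over $R_{\mathfrak m}$ for every maximal ideal $\mathfrak m$ of $R$. *)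

(* Defs.v *)
From HB Require Import structures.
From mathcomp Require Import all_boot all_order all_algebra.
Set Implicit Arguments. Unset Strict Implicit. Unset Printing Implicit Defensive.
Import GRing.Theory.
Local Open Scope ring_scope.

Section Generic.
Variable R : comPzRingType.

Definition ideal (I : R -> Prop) : Prop :=
  I 0 /\ (forall x y, I x -> I y -> I (x + y)) /\ (forall r x, I x -> I (r * x)).

Definition maximal_ideal (m : R -> Prop) : Prop :=
  ideal m /\ ~ m 1 /\
  forall J, ideal J -> (forall x, m x -> J x) -> (forall x, J x -> m x) \/ J 1.

Definition is_linear (U V : lmodType R) (f : U -> V) : Prop :=
  forall a x y, f (a *: x + y) = a *: f x + f y.

Variable M : lmodType R.

Definition fg_projective : Prop :=
  exists k (f : M -> 'rV[R]_k) (g : 'rV[R]_k -> M),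
    is_linear f /\ is_linear g /\ cancel f g.

Definition sym_bilinear (B : M -> M -> R) : Prop :=
  (forall x y, B x y = B y x) /\ (forall y, is_linear (V := R^o) (fun x => B x y)).

Definition nondegenerate (B : M -> M -> R) : Prop :=
  (forall p, (forall q, B p q = 0) -> p = 0) /\
  (forall phi : M -> R, is_linear (V := R^o) phi -> exists p, forall q, phi q = B p q).

(* orthogonal module (the rank condition is stated separately) *)
Definition orthogonal_module (B : M -> M -> R) : Prop :=
  fg_projective /\ sym_bilinear B /\ nondegenerate B.

Definition unimodular (u : M) : Prop :=
  exists phi : M -> R, is_linear (V := R^o) phi /\ phi u = 1.

Definition inIM (I : R -> Prop) (x : M) : Prop :=
  exists k (a : 'I_k -> R) (p : 'I_k -> M),
    (forall i, I (a i)) /\ x = \sum_(i < k) a i *: p i.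

Definition otransvection (B : M -> M -> R) (u v : M) : M -> M :=
  fun m => m - B u m *: v + B v m *: u.

Definition is_otrans_rel (B : M -> M -> R) (I : R -> Prop) (f : M -> M) : Prop :=
  exists u v, B u u = 0 /\ B v v = 0 /\ B u v = 0 /\
    (unimodular u \/ unimodular v) /\ (inIM I u \/ inIM I v) /\
    f =1 otransvection B u v.

Inductive genGroup (S : (M -> M) -> Prop) : (M -> M) -> Prop :=
| gen_id : genGroup S id
| gen_mul s g : S s -> genGroup S g -> genGroup S (s \o g)
| gen_inv s h g : S s -> cancel s h -> cancel h s -> genGroup S g ->
    genGroup S (h \o g).

Definition inGroup (S : (M -> M) -> Prop) (f : M -> M) : Prop :=
  exists g, genGroup S g /\ f =1 g.

Definition TransO (B : M -> M -> R) (I : R -> Prop) : (M -> M) -> Prop :=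
  inGroup (is_otrans_rel B I).

(* an element x/s of M_m is represented by a pair (x, s) with s \notin m *)
Definition lvalid (m : R -> Prop) (x : M * R) : Prop := ~ m x.2.

Definition locEq (m : R -> Prop) (x y : M * R) : Prop :=
  exists u, ~ m u /\ u *: (y.2 *: x.1 - x.2 *: y.1) = 0.

Definition locadd (x y : M * R) : M * R := (y.2 *: x.1 + x.2 *: y.1, x.2 * y.2).
Definition locscale (c : R * R) (x : M * R) : M * R := (c.1 *: x.1, c.2 * x.2).
Definition loczero : M * R := (0, 1).
Definition locsum k (f : 'I_k -> M * R) : M * R :=
  foldr locadd loczero [seq f i | i <- enum 'I_k].

End Generic.
Arguments loczero {R M}.

Section Generic2.
Variable R : comPzRingType.
Variable M : lmodType R.

Definition locSub (m : R -> Prop) (N : M * R -> Prop) : Prop :=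
  (forall x y, lvalid m x -> lvalid m y -> locEq m x y -> N x -> N y) /\
  N loczero /\
  (forall x y, lvalid m x -> lvalid m y -> N x -> N y -> N (locadd x y)) /\
  (forall c x, ~ m c.2 -> lvalid m x -> N x -> N (locscale c x)).

Definition locSummand (m : R -> Prop) (N : M * R -> Prop) : Prop :=
  locSub m N /\
  exists C, locSub m C /\
    (forall x, lvalid m x -> exists y z, lvalid m y /\ lvalid m z /\
        N y /\ C z /\ locEq m x (locadd y z)) /\
    (forall x, lvalid m x -> N x -> C x -> locEq m x loczero).

Definition loc_free_rank (m : R -> Prop) (r : nat) : Prop :=
  exists e : 'I_r -> M * R, (forall i, lvalid m (e i)) /\
    (forall x, lvalid m x -> exists c : 'I_r -> R * R, (forall i, ~ m (c i).2) /\
        locEq m x (locsum (fun i => locscale (c i) (e i)))) /\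
    (forall c : 'I_r -> R * R, (forall i, ~ m (c i).2) ->
        locEq m (locsum (fun i => locscale (c i) (e i))) loczero ->
        forall i, locEq (M := R^o) m (c i) (0, 1)).

Definition has_rank (r : nat) : Prop :=
  forall m, maximal_ideal m -> loc_free_rank m r.

Definition locform (B : M -> M -> R) (x y : M * R) : R * R := (B x.1 y.1, x.2 * y.2).

Definition locPerp (m : R -> Prop) (B : M -> M -> R) (N : M * R -> Prop) (x : M * R) :=
  forall y, lvalid m y -> N y -> locEq (M := R^o) m (locform B x y) (0, 1).

Definition split_at (m : R -> Prop) (B : M -> M -> R) : Prop :=
  exists N, locSummand m N /\
    forall x, lvalid m x -> (N x <-> locPerp m B N x).

Definition locally_split (B : M -> M -> R) : Prop :=
  forall m, maximal_ideal m -> split_at m B.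

End Generic2.

Section Qdefs.
Variable R : comPzRingType.
Variable P : lmodType R.

Definition Qmod : lmodType R := ((R^o * R^o) * P)%type.

Definition Qform (B : P -> P -> R) (x y : Qmod) : R :=
  (x.1.1 : R) * (y.1.2 : R) + (y.1.1 : R) * (x.1.2 : R) + B x.2 y.2.

Definition rho (B : P -> P -> R) (q : P) (x : Qmod) : Qmod :=
  ((x.1.1, (x.1.2 : R) + B x.2 q), x.2 - (x.1.1 : R) *: q).
Definition mu (B : P -> P -> R) (q : P) (x : Qmod) : Qmod :=
  (((x.1.1 : R) + B x.2 q, x.1.2), x.2 - (x.1.2 : R) *: q).

Definition elem_gen (B : P -> P -> R) (J : P -> Prop) (f : Qmod -> Qmod) : Prop :=
  exists q, B q q = 0 /\ J q /\ (f =1 rho B q \/ f =1 mu B q).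

Definition ETransO (B : P -> P -> R) : (Qmod -> Qmod) -> Prop :=
  inGroup (elem_gen B (fun _ => True)).

Definition ETransO_I (B : P -> P -> R) (I : R -> Prop) : (Qmod -> Qmod) -> Prop :=
  inGroup (elem_gen B (inIM I)).

Definition conj_gen (B : P -> P -> R) (I : R -> Prop) (f : Qmod -> Qmod) : Prop :=
  exists e e' g, ETransO B e /\ cancel e e' /\ cancel e' e /\
    ETransO_I B I g /\ f =1 e \o g \o e'.

Definition ETransO_rel (B : P -> P -> R) (I : R -> Prop) : (Qmod -> Qmod) -> Prop :=
  inGroup (conj_gen B I).

Definition TransO_Q (B : P -> P -> R) (I : R -> Prop) : (Qmod -> Qmod) -> Prop :=
  TransO (Qform B) I.

End Qdefs.

(* Main.v *)
(** For [u] isotropic and [v] orthogonal to [u], with [q v = <v,v>/2], put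
    [E(u,v) m = m - <u,m> v + <v,m> u - q(v) <u,m> u]; this is additive in [v], is conjugated
    by an isometry [g] into [E(gu,gv)], and is a transvection when [v] is isotropic.
    The [rho(q)] and [mu(q)] are the maps [E(f,q)] and [E(e,q)] for the hyperbolic basis [e, f].
    For fixed [u], the scalars [l] such that [E(u, l v)] lies in the relative elementary group
    for all [v] in [IQ] orthogonal to [u] form an ideal by additivity, so it suffices to find
    such an [l] outside each maximal ideal [m]. No localization is needed for that: a splitting
    of [P_m] yields elements of [P] itself forming two orthogonal hyperbolic pairs up to scalars
    outside [m]. After moving [u = a e + b f + p] so that [a] is outside [m], consider
    [T(w) = E(u, a w - <p,w> f)] for [w] in [P]. It is elementary when [w] is isotropic and
    orthogonal to [p], and commutators of such maps with [E(x,y)], for [x, y] in [P], produce all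
    [T(s w)], [w] in [IP], for one [s] outside [m]; finally [E(u, a^2 v) = T(a w - c p)] for
    [v = c e + d f + w]. *)
Require Import Defs.
From HB Require Import structures.
From mathcomp Require Import all_boot all_order all_algebra.
From mathcomp Require Import ring boolp.
From mathcomp Require classical_sets.
Set Implicit Arguments. Unset Strict Implicit. Unset Printing Implicit Defensive.
Import GRing.Theory.
Local Open Scope ring_scope.

(** Groups of maps are predicates closed under pointwise equality, and inversion is stated for any
    two-sided inverse, so no inverse has to be chosen. *)
Record subgroup (T : Type) (G : (T -> T) -> Prop) : Prop := Subgroup {
  sg_ext : forall f g, f =1 g -> G f -> G g;
  sg_id : G id;
  sg_comp : forall f g, G f -> G g -> G (f \o g);
  sg_inv : forall f f', G f -> cancel f f' -> cancel f' f -> G f' }.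

Definition normalized_by (T : Type) (G H : (T -> T) -> Prop) : Prop :=
  forall g g' k, G g -> cancel g g' -> cancel g' g -> H k -> H (g \o k \o g').

(** * Maximal ideals *)

Record prime_ideal (R : comPzRingType) (m : R -> Prop) : Prop := PrimeIdeal {
  prime_is_ideal : ideal m;
  prime_ideal_proper : ~ m 1;
  prime_idealM : forall x y, ~ m x -> ~ m y -> ~ m (x * y) }.

Lemma maximal_prime (R : comPzRingType) (m : R -> Prop) :
  maximal_ideal m -> prime_ideal m.
Proof.
case=> -[m0 [mD mM]] [m1 mmax]; split=> // x y mx my mxy.
pose J z := exists a b, m b /\ z = a * x + b.
have [|z mz|Jm|[a [b [mb ab]]]] := mmax J.
- split; first by exists 0, 0; split=> //; rewrite mul0r addr0.
  split=> [z z' [a [b [mb ->]]] [a' [b' [mb' ->]]]|r z [a [b [mb ->]]]].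
    by exists (a + a'), (b + b'); split; [exact: mD|ring].
  by exists (r * a), (r * b); split; [exact: mM|ring].
- by exists 0, z; rewrite mul0r add0r.
- by apply: mx; apply: Jm; exists 1, 0; rewrite mul1r addr0.
apply: my; have -> : y = a * (x * y) + y * b by rewrite -{1}[y]mulr1 ab; ring.
by apply: mD; apply: mM.
Qed.

Lemma exists_maximal_ideal (R : comPzRingType) (J : R -> Prop) :
    ideal J -> ~ J 1 ->
  exists m, maximal_ideal m /\ (forall x, J x -> m x).
Proof.
move=> idJ J1.
(* The empty set is admitted because Zorn's lemma also considers the empty chain. *)
pose S (X : classical_sets.set R) :=
  (forall x, ~ X x) \/ [/\ ideal X, ~ X 1 & forall x, J x -> X x].
have [F FS Ftot|m [Sm mmax]] := @classical_sets.Zorn_bigcup R S.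
  have [[X [FX [x Xx]]]|F0] := pselect (exists X, F X /\ exists x, X x); last first.
    by left=> x [X FX Xx]; apply: F0; exists X; split=> //; exists x.
  have SF Y : F Y -> (exists y, Y y) -> [/\ ideal Y, ~ Y 1 & forall x, J x -> Y x].
    by move=> /FS [Y0 [y /Y0]|].
  have [[X0 _] _ JX] := SF X FX (ex_intro _ x Xx).
  right; split=> [||y Jy]; last by exists X => //; apply: JX.
    split; first by exists X.
    split=> [y z [Y FY Yy] [Z FZ Zz]|r y [Y FY Yy]]; last first.
      by exists Y => //; have [[_ [_ YM]] _ _] := SF Y FY (ex_intro _ y Yy); apply: YM.
    have [YZ|ZY] := Ftot Y Z FY FZ.
      exists Z => //; have [[_ [ZD _]] _ _] := SF Z FZ (ex_intro _ z Zz).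
      by apply: ZD => //; apply: YZ.
    exists Y => //; have [[_ [YD _]] _ _] := SF Y FY (ex_intro _ y Yy).
    by apply: YD => //; apply: ZY.
  by case=> Y FY Y1; have [_] := SF Y FY (ex_intro _ 1 Y1).
(* The maximal element is not the empty set, which would lie properly below [J]. *)
have {Sm} [m0|[idm m1 Jm]] := Sm.
  have SJ : S J by right; split.
  suff ltmJ : classical_sets.proper m J by case: (mmax J ltmJ SJ).
  split=> [x /m0 //|Jm]; exact: (m0 0 (Jm _ (proj1 idJ))).
exists m; split=> //; split=> //; split=> // K idK mK.
have [K1|K1] := pselect (K 1); first by right.
left; apply: contrapT => Km; apply: (mmax K); first by split.
by right; split=> // x /Jm /mK.
Qed.

(** This replaces localization: an ideal without 1 would lie in a maximal ideal, and that ideal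
    misses one of its elements. *)
Lemma ideal_local_global (R : comPzRingType) (J : R -> Prop) : ideal J ->
  (forall m, maximal_ideal m -> exists s, ~ m s /\ J s) -> J 1.
Proof.
move=> idJ loc; apply: contrapT => J1.
have [m [mm Jm]] := exists_maximal_ideal idJ J1.
by have [s [ms /Jm]] := loc m mm.
Qed.

(** * Multiples of an ideal in a module *)

Section IdealMultiples.
Variables (R : comPzRingType) (I : R -> Prop).

Lemma inIMZ (M : lmodType R) a (x : M) : inIM I x -> inIM I (a *: x).
Proof.
move=> [k [c [p [Ic ->]]]]; exists k, c, (fun i => a *: p i); split=> //.
rewrite scaler_sumr; apply: eq_bigr => i _.
by rewrite !scalerA mulrC.
Qed.

Lemma inIMN (M : lmodType R) (x : M) : inIM I x -> inIM I (- x).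
Proof. by move=> /(inIMZ (-1)); rewrite scaleN1r. Qed.

Lemma inIMD (M : lmodType R) (x y : M) :
  inIM I x -> inIM I y -> inIM I (x + y).
Proof.
move=> [k [c [p [Ic ->]]]] [l [d [q [Id ->]]]].
pose cd j := match split j with inl i => c i | inr i => d i end.
pose pq j := match split j with inl i => p i | inr i => q i end.
exists (k + l)%N, cd, pq; split.
  by move=> j; rewrite /cd; case: (split j).
rewrite big_split_ord; congr (_ + _); apply: eq_bigr => i _; rewrite /cd /pq.
  by have := unsplitK (inl i : 'I_k + 'I_l)%type; rewrite /= => ->.
by have := unsplitK (inr i : 'I_k + 'I_l)%type; rewrite /= => ->.
Qed.

Lemma inIM_scale (M : lmodType R) a (x : M) : I a -> inIM I (a *: x).
Proof.
by move=> Ia; exists 1%N, (fun=> a), (fun=> x); split=> //; rewrite big_ord1.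
Qed.

Lemma inIM_linear (M N : lmodType R) (g : M -> N) x :
  is_linear g -> inIM I x -> inIM I (g x).
Proof.
move=> lg [k [c [p [Ic ->]]]]; exists k, c, (g \o p); split=> //.
have g0 : g 0 = 0.
  have := lg 1 0 0; rewrite scaler0 add0r scale1r => /esym.
  by move=> e; apply: (addrI (g 0)); rewrite e addr0.
apply: (big_ind2 (fun u v => g u = v)) => // [u u' v v' <- <-|i _].
  by rewrite -[u]scale1r lg !scale1r.
by rewrite -[_ *: _]addr0 lg g0 addr0.
Qed.

Lemma inIM_form (M : lmodType R) (C : M -> M -> R) x y :
  ideal I -> sym_bilinear C -> inIM I x -> I (C x y).
Proof.
move=> [I0 [ID IZ]] bC [k [c [p [Ic ->]]]].
have fD := bC.2 y; have f0 : C 0 y = 0.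
  have := fD 1 0 0; rewrite scaler0 add0r /GRing.scale /= mul1r => /esym e.
  by apply: (addrI (C 0 y)); rewrite e addr0.
elim/big_rec: _ => [|i x' _ Ix]; first by rewrite f0.
rewrite fD; apply: ID => //; rewrite /GRing.scale /= mulrC; exact: IZ.
Qed.

End IdealMultiples.

(** * Eichler transformations *)

Section Bilinear.
Variables (R : comPzRingType) (M : lmodType R) (C : M -> M -> R).
Hypothesis bilC : sym_bilinear C.

Lemma bformC x y : C x y = C y x. Proof. by case: bilC. Qed.
Lemma bformDl x y z : C (x + y) z = C x z + C y z.
Proof. by case: bilC => _ /(_ z 1 x y); rewrite scale1r /= /GRing.scale /= mul1r. Qed.
Lemma bform0l z : C 0 z = 0.
Proof. by apply: (addrI (C 0 z)); rewrite -bformDl !addr0. Qed.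
Lemma bformZl a x z : C (a *: x) z = a * C x z.
Proof. by case: bilC => _ /(_ z a x 0); rewrite !addr0 bform0l /GRing.scale /= addr0. Qed.
Lemma bformNl x z : C (- x) z = - C x z.
Proof. by rewrite -scaleN1r bformZl mulN1r. Qed.
Lemma bformDr x y z : C z (x + y) = C z x + C z y.
Proof. by rewrite !(bformC z) bformDl. Qed.
Lemma bform0r z : C z 0 = 0. Proof. by rewrite bformC bform0l. Qed.
Lemma bformZr a x z : C z (a *: x) = a * C z x.
Proof. by rewrite !(bformC z) bformZl. Qed.
Lemma bformNr x z : C z (- x) = - C z x.
Proof. by rewrite !(bformC z) bformNl. Qed.

Definition bformE :=
  (bformDl, bformDr, bformNl, bformNr, bformZl, bformZr, bform0l, bform0r).

Variable h : R.
Hypothesis half : 2%:R * h = 1.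
Hypothesis ndC : forall x, (forall y, C x y = 0) -> x = 0.

(* [ring] cannot rewrite with [half], so the multiple of it that is needed is given as [X]. *)
Lemma eq_mod_half X a b : a - b = (2%:R * h - 1) * X -> a = b.
Proof. by rewrite half subrr mul0r => /eqP; rewrite subr_eq0 => /eqP. Qed.

(** Vectors are compared through their pairings with [t], which turns vector identities into scalar
    ones. *)
Lemma form_ext x y : (forall t, C x t = C y t) -> x = y.
Proof.
move=> xy; apply/eqP; rewrite -subr_eq0; apply/eqP/ndC => t.
by rewrite !bformE xy subrr.
Qed.

Definition eichler (u v m : M) : M :=
  m - C u m *: v + C v m *: u - (h * C v v * C u m) *: u.

Lemma eichler_linear u v : is_linear (eichler u v).
Proof. by move=> a x y; apply: form_ext => t; rewrite /eichler !bformE; ring. Qed.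

Lemma eichler0 u m : eichler u 0 m = m.
Proof. by apply: form_ext => t; rewrite /eichler !bformE; ring. Qed.

(** The composite produces the term [- C v w * C u m] along [u]; it is the cross term of
    [h * C (v + w) (v + w)], since [h] is one half. *)
Lemma eichlerD u v w m : C u u = 0 -> C u v = 0 -> C u w = 0 ->
  eichler u (v + w) m = eichler u v (eichler u w m).
Proof.
move=> uu uv uw; apply: form_ext => t.
rewrite /eichler !bformE (bformC v u) (bformC w v) uu uv uw.
by apply: (@eq_mod_half (- (C v w * C u m * C u t))); ring.
Qed.

Lemma eichlerK u v : C u u = 0 -> C u v = 0 ->
  cancel (eichler u v) (eichler u (- v)).
Proof.
move=> uu uv m; rewrite -eichlerD ?bformE ?uv ?oppr0 //.
by rewrite addNr eichler0.
Qed.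

Lemma eichlerVK u v : C u u = 0 -> C u v = 0 ->
  cancel (eichler u (- v)) (eichler u v).
Proof.
move=> uu uv m; rewrite -eichlerD ?bformE ?uv ?oppr0 //.
by rewrite addrN eichler0.
Qed.

Lemma eichler_isometry u v x y : C u u = 0 -> C u v = 0 ->
  C (eichler u v x) (eichler u v y) = C x y.
Proof.
move=> uu uv.
rewrite /eichler !bformE (bformC v u) (bformC x v) (bformC x u) uu uv.
by apply: (@eq_mod_half (- (C v v * C u x * C u y))); ring.
Qed.

Lemma eichler_conj (g g' : M -> M) u v m : is_linear g -> cancel g' g ->
    (forall x y, C (g x) (g y) = C x y) ->
  g (eichler u v (g' m)) = eichler (g u) (g v) m.
Proof.
move=> lg gK ig.
have g0 : g 0 = 0.
  by apply: ndC => t; rewrite -(gK t) ig bform0l.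
have gZ a x : g (a *: x) = a *: g x by rewrite -[a *: x]addr0 lg g0 addr0.
have gD x y : g (x + y) = g x + g y by rewrite -[x]scale1r lg !scale1r.
have gN x : g (- x) = - g x by rewrite -!scaleN1r gZ.
rewrite /eichler !(gD, gN, gZ) gK.
by rewrite -(ig u) -(ig v (g' m)) -(ig v v) gK.
Qed.

Lemma eichler_swap u v m : C u u = 0 -> C v v = 0 ->
  eichler u v m = eichler v (- u) m.
Proof.
by move=> uu vv; apply: form_ext => t; rewrite /eichler !bformE uu vv; ring.
Qed.

Lemma eichlerZ a u v m : eichler (a *: u) v m = eichler u (a *: v) m.
Proof. by apply: form_ext => t; rewrite /eichler !bformE; ring. Qed.

Lemma eichler_addl u v a m : C u u = 0 -> C u v = 0 ->
  eichler u (v + a *: u) m = eichler u v m.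
Proof.
move=> uu uv; apply: form_ext => t.
by rewrite /eichler !bformE (bformC v u) uu uv; ring.
Qed.

(** The values [d1] and [d2] replace 1 because the vectors lie in the module itself, where scalars
    outside a maximal ideal need not be invertible. *)
Record hyperbolic_pairs (d1 d2 : R) (x1 y1 x2 y2 : M) : Prop := HyperbolicPairs {
  hp_x1x1 : C x1 x1 = 0; hp_y1y1 : C y1 y1 = 0;
  hp_x2x2 : C x2 x2 = 0; hp_y2y2 : C y2 y2 = 0;
  hp_x1y1 : C x1 y1 = d1; hp_x2y2 : C x2 y2 = d2;
  hp_x1x2 : C x1 x2 = 0; hp_x1y2 : C x1 y2 = 0;
  hp_y1x2 : C y1 x2 = 0; hp_y1y2 : C y1 y2 = 0 }.

(* The last component [w3], orthogonal to both pairs, is the difference of the isotropic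
   vector [d2 y2 + d2 w3 - q(w3) x2] and of multiples of [x2] and [y2]. *)
Lemma hyperbolic_pairs_span d1 d2 x1 y1 x2 y2 (V K : M -> Prop) w :
    hyperbolic_pairs d1 d2 x1 y1 x2 y2 ->
    (forall x y, V x -> V y -> V (x + y)) -> (forall a x, V x -> V (a *: x)) ->
    V x1 -> V y1 -> V x2 -> V y2 ->
    (forall x y, V x -> V y -> K x -> K y -> K (x + y)) ->
    (forall l, K (l *: x1)) -> (forall l, K (l *: y1)) ->
    (forall z, V z -> C z z = 0 -> C x1 z = 0 -> C y1 z = 0 -> K z) ->
  V w -> K ((d1 * d2 ^+ 2) *: w).
Proof.
case=> x11 y11 x22 y22 xy1 xy2 xx xy yx yy VD VZ Vx1 Vy1 Vx2 Vy2 KD Kx1 Ky1 Kz Vw.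
have VN x : V x -> V (- x) by rewrite -scaleN1r; apply: VZ.
have [yx1 yx2] : C y1 x1 = d1 /\ C y2 x2 = d2 by split; rewrite bformC.
have [xx' xy'] : C x2 x1 = 0 /\ C y2 x1 = 0 by split; rewrite bformC.
have [yx' yy'] : C x2 y1 = 0 /\ C y2 y1 = 0 by split; rewrite bformC.
have simp := (x11, y11, x22, y22, xy1, xy2, xx, xy, (yx, yy, yx1, yx2, xx', xy', yx', yy')).
(* [w2] and [w3] remove from [w] its components along the first and then the second pair, with
   denominators cleared. *)
have [w2 w2E] : exists w2, w2 = d1 *: w - C w y1 *: x1 - C w x1 *: y1 by eexists.
have [w3 w3E] : exists w3, w3 = d2 *: w2 - C w2 y2 *: x2 - C w2 x2 *: y2 by eexists.
have Vw2 : V w2.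
  by rewrite w2E; apply: (VD); [apply: (VD)|]; (try apply: (VN)); apply: (VZ).
have Vw3 : V w3.
  by rewrite w3E; apply: (VD); [apply: (VD)|]; (try apply: (VN)); apply: (VZ).
have w2x : C x1 w2 = 0 by rewrite w2E !bformE !simp (bformC x1 w); ring.
have w2y : C y1 w2 = 0 by rewrite w2E !bformE !simp (bformC y1 w); ring.
have w3x1 : C x1 w3 = 0 by rewrite w3E !bformE !simp w2x; ring.
have w3y1 : C y1 w3 = 0 by rewrite w3E !bformE !simp w2y; ring.
have w3x : C w3 x2 = 0 by rewrite w3E !bformE !simp; ring.
have w3y : C w3 y2 = 0 by rewrite w3E !bformE !simp; ring.
have [xw3 yw3] : C x2 w3 = 0 /\ C y2 w3 = 0 by split; rewrite bformC.
have Kx2 l : K (l *: x2).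
  by apply: (Kz); [exact: VZ|..]; rewrite !bformE !simp; ring.
have Ky2 l : K (l *: y2).
  by apply: (Kz); [exact: VZ|..]; rewrite !bformE !simp; ring.
have [z zE] : exists z, z = d2 *: y2 + d2 *: w3 - (h * C w3 w3) *: x2 by eexists.
have Vz : V z.
  by rewrite zE; apply: (VD); [apply: (VD)|apply: (VN)]; apply: (VZ).
have K_z : K z.
  apply: (Kz) => //; last 2 first.
  - by rewrite zE !bformE !simp w3x1; ring.
  - by rewrite zE !bformE !simp w3y1; ring.
  rewrite zE !bformE !simp xw3 yw3 w3x w3y.
  by apply: (@eq_mod_half (- (d2 ^+ 2 * C w3 w3))); ring.
have -> : (d1 * d2 ^+ 2) *: w =
    z + ((C w2 y2 * d2 + h * C w3 w3) *: x2
    + ((C w2 x2 * d2 - d2) *: y2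
    + ((d2 ^+ 2 * C w y1) *: x1 + (d2 ^+ 2 * C w x1) *: y1))).
  by apply: form_ext => t; rewrite zE w3E !bformE w2E !bformE; ring.
by do !(apply: (KD) || apply: (VD) || apply: (VZ) || done).
Qed.

(** * Elementary maps attached to a hyperbolic plane *)

Variables e f : M.
Hypotheses (ee : C e e = 0) (ff : C f f = 0) (ef : C e f = 1).

Definition perp_ef (x : M) : Prop := C e x = 0 /\ C f x = 0.

Lemma perp_efZ a x : perp_ef x -> perp_ef (a *: x).
Proof. by case=> ex fx; split; rewrite !bformE ?ex ?fx mulr0. Qed.

Lemma perp_efN x : perp_ef x -> perp_ef (- x).
Proof. by move=> /(@perp_efZ (- 1)); rewrite scaleN1r. Qed.

Lemma perp_efD x y : perp_ef x -> perp_ef y -> perp_ef (x + y).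
Proof.
by move=> [ex fx] [ey fy]; split; rewrite !bformE ?ex ?fx ?ey ?fy addr0.
Qed.

(** Abstracts the absolute group [G] and the relative group [H]. The generators are taken for all
    [p], isotropic or not; for [Q] this is justified by [isotropic_ind]. *)
Record elementary_pair (I : R -> Prop) (G H : (M -> M) -> Prop) : Prop :=
  ElementaryPair {
    ep_G : subgroup G;
    ep_H : subgroup H;
    ep_sub : forall g, H g -> G g;
    ep_normal : normalized_by G H;
    ep_genG : forall p, perp_ef p -> G (eichler e p) /\ G (eichler f p);
    ep_genH : forall p, perp_ef p -> inIM I p ->
      H (eichler e p) /\ H (eichler f p) }.

(** Lets the relative lemmas be applied to [G] itself, as the case of the unit ideal. *)
Lemma elementary_pair_full I G H :
  elementary_pair I G H -> elementary_pair (fun=> True) G G.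
Proof.
case=> sG sH HG nGH gG gH; split=> // [g g' k Gg gK g'K Gk|p Pp _].
  by apply: (sg_comp sG (sg_comp sG Gg Gk)); apply: (sg_inv sG Gg).
exact: gG.
Qed.

(** With [q = h * C p p], conjugating [E(e, w)] by [E(f, p)] gives
    [E(e - p - q f, w) = E(w, p + q f - e)]. The factors [E(e, -w) = E(w, e)] and
    [E(f, q w) = E(w, -q f)] cancel the unwanted terms. *)
Lemma eichler_in_perp I G H w p : elementary_pair I G H ->
    perp_ef w -> inIM I w -> C w w = 0 -> perp_ef p -> C w p = 0 ->
  H (eichler w p).
Proof.
move=> EP [ew fw] Iw ww [ep fp] wp.
have Pw : perp_ef w by [].
have Pp : perp_ef p by [].
have we : C w e = 0 by rewrite bformC.
have wf : C w f = 0 by rewrite bformC.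
pose q := h * C p p.
have Hk : H (eichler f p \o eichler e w \o eichler f (- p)).
  apply: (ep_normal EP); [by case: (ep_genG EP Pp)|exact: eichlerK|exact: eichlerVK|].
  by case: (ep_genH EP Pw Iw).
have Hf : H (eichler f (q *: w)).
  by case: (ep_genH EP (perp_efZ q Pw) (inIMZ q Iw)).
have He : H (eichler e (- w)).
  by case: (ep_genH EP (perp_efN Pw) (inIMN Iw)).
apply: (sg_ext (ep_H EP) _ (sg_comp (ep_H EP) He (sg_comp (ep_H EP) Hk Hf))).
move=> m /=.
rewrite (eichler_conj _ _ _ (eichler_linear f p) (eichlerVK _ _)) //; last first.
  by move=> x y; apply: eichler_isometry.
have iso : C (eichler f p e) (eichler f p e) = 0 by rewrite eichler_isometry.
have fpe : eichler f p e = - (p + (q *: f - e)).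
  apply: form_ext => t.
  by rewrite /eichler /q !bformE (bformC f e) ef (bformC p e) ep; ring.
have -> : eichler f p w = w.
  by rewrite /eichler fw (bformC p) wp mulr0 !scale0r !(subr0, addr0).
rewrite [eichler (eichler f p e) w _]eichler_swap // fpe opprK.
rewrite -[eichler e (- w) _]eichler_swap // -eichlerZ.
rewrite [eichler (q *: f) w m]eichler_swap ?bformE ?ff ?mulr0 //.
rewrite -!eichlerD ?bformE ?we ?wf ?wp ?mulr0 ?oppr0 ?addr0 //.
by congr eichler; apply: form_ext => t; rewrite !bformE; ring.
Qed.

(** * The maps [T(w)] of a fixed isotropic vector *)

Section Slide.
Variables (a b : R) (p u : M).
Hypotheses (Pp : perp_ef p) (uE : u = a *: e + b *: f + p) (uu : C u u = 0).

(* The coefficient of [f] makes the argument orthogonal to [u] without dividing by [a]. *)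
Definition slide (w : M) : M -> M := eichler u (a *: w - C p w *: f).

Let ep : C e p = 0 := proj1 Pp.
Let fp : C f p = 0 := proj2 Pp.
Let pe : C p e = 0. Proof. by rewrite bformC. Qed.
Let pf : C p f = 0. Proof. by rewrite bformC. Qed.
Let fe : C f e = 1. Proof. by rewrite bformC. Qed.

Lemma slide_perp w : perp_ef w -> C u (a *: w - C p w *: f) = 0.
Proof.
by move=> [ew fw]; rewrite uE !bformE ew fw ef pf ff; ring.
Qed.

Lemma slideD w w' m : perp_ef w -> perp_ef w' ->
  slide (w + w') m = slide w (slide w' m).
Proof.
move=> Pw Pw'; rewrite /slide -eichlerD ?slide_perp //.
by congr eichler; apply: form_ext => t; rewrite !bformE; ring.
Qed.

Lemma slideK w : perp_ef w -> cancel (slide w) (slide (- w)).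
Proof.
move=> Pw m; rewrite -slideD ?addNr; [|exact: perp_efN|done].
by rewrite /slide scaler0 bform0r // scale0r subr0 eichler0.
Qed.

Lemma slideVK w : perp_ef w -> cancel (slide (- w)) (slide w).
Proof. by move=> Pw; rewrite -{2}[w]opprK; apply: slideK; apply: perp_efN. Qed.

(** Here [T(w) = E(u, a w) = E(w, -a u)]. Splitting [u] into its three components gives
    [E(e, a^2 w)], [E(f, a b w)] and [E(w, -a p)], the last covered by [eichler_in_perp]. *)
Lemma slide_perp_in I G H w : elementary_pair I G H ->
  perp_ef w -> inIM I w -> C w w = 0 -> C p w = 0 -> H (slide w).
Proof.
move=> EP Pw Iw ww pw; have [ew fw] := Pw.
have we : C w e = 0 by rewrite bformC.
have wf : C w f = 0 by rewrite bformC.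
have wp : C w p = 0 by rewrite bformC.
have He := (ep_genH EP (perp_efZ (a ^+ 2) Pw) (inIMZ (a ^+ 2) Iw)).1.
have Hf := (ep_genH EP (perp_efZ (a * b) Pw) (inIMZ (a * b) Iw)).2.
have Hp : H (eichler w (- (a *: p))).
  apply: (eichler_in_perp EP) => //; first exact/perp_efN/perp_efZ.
  by rewrite !bformE wp mulr0 oppr0.
apply: (sg_ext (ep_H EP) _ (sg_comp (ep_H EP) He (sg_comp (ep_H EP) Hf Hp))).
move=> m /=; rewrite /slide pw scale0r subr0 -!eichlerZ.
rewrite !(eichler_swap _ (v := w)) ?bformE ?ww ?ee ?ff ?uu ?mulr0 //.
rewrite -!eichlerD ?bformE ?we ?wf ?wp ?mulr0 ?oppr0 ?addr0 //.
by congr eichler; apply: form_ext => t; rewrite uE !bformE; ring.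
Qed.

(* The maps [E(l x, a y)] and [E(f, r)] send [u] to the same vector, as well as
   [a z - <p,z> f] and its analogue for [z + z1]; hence they conjugate [slide z] and
   [slide (z + z1)] into the same map, and [slide z1] is a commutator up to [E(f, r)]. *)
Lemma slide_commutator I G H x y z l : elementary_pair I G H -> I l ->
    perp_ef x -> perp_ef y -> perp_ef z ->
    C x x = 0 -> C y y = 0 -> C x y = 0 -> G (slide z) ->
  H (slide ((l * a) *: (C y z *: x - C x z *: y))).
Proof.
move=> EP Il Px Py Pz xx yy xy Gz; have [[[ex fx] [ey fy]] [ez fz]] := (Px, Py, Pz).
have yx : C y x = 0 by rewrite bformC.
have xe : C x e = 0 by rewrite bformC.
have xf : C x f = 0 by rewrite bformC.
have ye : C y e = 0 by rewrite bformC.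
have yf : C y f = 0 by rewrite bformC.
set z1 := (_ *: _).
have Pz1 : perp_ef z1.
  by apply/perp_efZ/perp_efD; [|apply: perp_efN]; apply: perp_efZ.
pose r := l *: (C x p *: y - C y p *: x).
have Ir : inIM I r by apply: inIM_scale.
have Pr : perp_ef r.
  by apply/perp_efZ/perp_efD; [|apply: perp_efN]; apply: perp_efZ.
pose g := eichler (l *: x) (a *: y).
pose g' := eichler (l *: x) (- (a *: y)).
have xx' : C (l *: x) (l *: x) = 0 by rewrite !bformE xx !mulr0.
have xy' : C (l *: x) (a *: y) = 0 by rewrite !bformE xy !mulr0.
have gK : cancel g g' by apply: eichlerK.
have g'K : cancel g' g by apply: eichlerVK.
have Hg : H g.
  apply: (eichler_in_perp EP); rewrite ?bformE ?xy ?xx ?mulr0 //.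
  - exact: perp_efZ.
  - exact: inIM_scale.
  - exact: perp_efZ.
pose k := eichler f r; pose k' := eichler f (- r).
have fr : C f r = 0 by case: Pr.
have kK : cancel k k' by apply: eichlerK.
have k'K : cancel k' k by apply: eichlerVK.
have Hk : H k by case: (ep_genH EP Pr Ir).
have sH := ep_H EP.
have Hk' : H k' := sg_inv sH Hk kK k'K.
have Hg' : H g' := sg_inv sH Hg gK g'K.
(* The conjugating map [slide z] is only known to lie in [G]; normality of [H] is what puts the
   commutator into [H]. *)
have Hc : H (slide z \o (g' \o k) \o slide (- z)).
  apply: (ep_normal EP) => //; [exact: slideK|exact: slideVK|exact: sg_comp].
apply: (sg_ext sH _ (sg_comp sH (sg_comp sH Hk' Hg) Hc)) => m /=.
suff conj n : g (slide z (g' n)) = k (slide (z + z1) (k' n)).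
  by rewrite conj !kK addrC slideD ?slideVK.
have gg i j : C (g i) (g j) = C i j by apply: eichler_isometry.
have kk i j : C (k i) (k j) = C i j by apply: eichler_isometry.
have lg : is_linear g by apply: eichler_linear.
have lk : is_linear k by apply: eichler_linear.
rewrite /slide (eichler_conj _ _ _ lg g'K gg) (eichler_conj _ _ _ lk k'K kk).
congr eichler; apply: form_ext => t.
  rewrite /eichler uE /r !bformE ?(xx,yy,xy,yx,xe,xf,ye,yf,ep,fp,fe,ef,ff,ee,ex,fx,ey,fy).
  rewrite ?(bformC p x) ?(bformC p y).
  ring.
rewrite /eichler /r /z1 !bformE ?(xx,yy,xy,yx,xe,xf,ye,yf,ep,fp,fe,ef,ff,ee,ex,fx,ey,fy,ez,fz).
rewrite ?(bformC p x) ?(bformC p y) ?(bformC z x) ?(bformC z y).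
ring.
Qed.

(** * All [T(w)] from two hyperbolic pairs *)

Variables (d1 d2 : R) (x1 y1 x2 y2 : M).
Hypotheses (Px1 : perp_ef x1) (Py1 : perp_ef y1) (Px2 : perp_ef x2) (Py2 : perp_ef y2).
Hypothesis hyp : hyperbolic_pairs d1 d2 x1 y1 x2 y2.
Let c := C p x1.

(** The vector [z = c x2 - C p x2 x1] is isotropic and orthogonal to [p], so [T(z)] lies in [G]. Its
    commutator for [x1] and [y2] involves only [x1], because [C x1 z = 0] and [C y2 z = c * d2]. *)
Lemma slide_x1 I G H l : elementary_pair I G H -> I l ->
  H (slide ((l * (a * c * d2)) *: x1)).
Proof.
move=> EP Il; have EPT := elementary_pair_full EP.
pose z := c *: x2 - C p x2 *: x1.
have [x11 _ x22 _ _ xy2 xx xy _ _] := hyp.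
have Pz : perp_ef z by apply: perp_efD; [|apply: perp_efN]; apply: perp_efZ.
have xx' : C x2 x1 = 0 by rewrite bformC.
have Gz : G (slide z).
  apply: (slide_perp_in EPT) => //.
  - by rewrite -[z]scale1r; apply: inIM_scale.
  - by rewrite !bformE x11 x22 xx xx'; ring.
  - by rewrite !bformE /c; ring.
have := slide_commutator EP Il Px1 Py2 Pz x11 (hp_y2y2 hyp) xy Gz.
suff -> : (l * a) *: (C y2 z *: x1 - C x1 z *: y2) = (l * (a * c * d2)) *: x1 by [].
apply: form_ext => t.
by rewrite !bformE (bformC y2 x2) (bformC y2 x1) xy2 xx xy x11; ring.
Qed.

(** Subtracting a multiple of [x1] from [c z] makes it orthogonal to [p] and keeps it isotropic;
    [slide_x1] restores the multiple. *)
Lemma slide_perp_x1 I G H l z : elementary_pair I G H -> ideal I -> I l ->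
    perp_ef z -> C z z = 0 -> C x1 z = 0 ->
  H (slide ((l * (a * c ^+ 2 * d2)) *: z)).
Proof.
move=> EP [I0 [ID IZ]] Il Pz zz xz.
have x11 := hp_x1x1 hyp.
have zx : C z x1 = 0 by rewrite bformC.
pose z' := c *: z - C p z *: x1.
have Pz' : perp_ef z' by apply: perp_efD; [|apply: perp_efN]; apply: perp_efZ.
have H1 : H (slide ((l * (a * c * d2)) *: z')).
  apply: (slide_perp_in EP); first exact: perp_efZ.
  - by apply: inIM_scale; rewrite mulrC; apply: IZ.
  - by rewrite !bformE zz xz zx x11; ring.
  - by rewrite !bformE /c; ring.
have H2 : H (slide (((l * C p z) * (a * c * d2)) *: x1)).
  by apply: slide_x1 EP _; rewrite mulrC; apply: IZ.
apply: (sg_ext (ep_H EP) _ (sg_comp (ep_H EP) H1 H2)) => m /=.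
rewrite -slideD; [|exact: perp_efZ|exact: perp_efZ].
by congr slide; apply: form_ext => t; rewrite !bformE; ring.
Qed.

(** A second commutator, now for [y1], [y2] and a multiple of [x2] whose [T] lies in [G] by
    [slide_perp_x1] over the unit ideal. *)
Lemma slide_y1 I G H l : elementary_pair I G H -> I l ->
  H (slide ((l * (a * c * d2) ^+ 2) *: y1)).
Proof.
move=> EP Il; have EPT := elementary_pair_full EP.
have [_ y11 x22 y22 _ xy2 xx _ yx yy] := hyp.
pose z := (1 * (a * c ^+ 2 * d2)) *: x2.
have Pz : perp_ef z by apply: perp_efZ.
have Gz : G (slide z) by apply: (slide_perp_x1 EPT).
have := slide_commutator EP Il Py1 Py2 Pz y11 y22 yy Gz.
suff -> : (l * a) *: (C y2 z *: y1 - C y1 z *: y2) = (l * (a * c * d2) ^+ 2) *: y1 by [].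
apply: form_ext => t.
by rewrite !bformE (bformC y2 x2) xy2 yx; ring.
Qed.

(** The square is a common multiple of the constants in [slide_x1], [slide_perp_x1] and [slide_y1];
    the other factor comes from [hyperbolic_pairs_span]. *)
Definition slide_factor := (a * c * d2) ^+ 2 * (d1 * d2 ^+ 2).

Lemma slide_scale I G H l w : elementary_pair I G H -> ideal I -> I l ->
  perp_ef w -> H (slide ((l * slide_factor) *: w)).
Proof.
move=> EP idI Il Pw; have [I0 [ID IZ]] := idI.
pose S := (a * c * d2) ^+ 2.
pose K v := H (slide ((l * S) *: v)).
suff: K ((d1 * d2 ^+ 2) *: w) by rewrite /K scalerA -mulrA.
have IMr k m : I k -> I (k * m) by rewrite mulrC; apply: IZ.
apply: (hyperbolic_pairs_span (V := perp_ef) (K := K) hyp) => //; rewrite /K.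
- exact: perp_efD.
- exact: perp_efZ.
- move=> x y Px Py Hx Hy; apply: (sg_ext (ep_H EP) _ (sg_comp (ep_H EP) Hx Hy)) => m /=.
  by rewrite -slideD -?scalerDr //; apply: perp_efZ.
- move=> k; rewrite scalerA.
  have -> : l * S * k = (l * (k * (a * c * d2))) * (a * c * d2) by rewrite /S; ring.
  exact/(slide_x1 EP)/IMr.
- move=> k; rewrite scalerA.
  have -> : l * S * k = (l * k) * (a * c * d2) ^+ 2 by rewrite /S; ring.
  exact/(slide_y1 EP)/IMr.
- move=> z Pz zz x1z _.
  have -> : l * S = (l * (a * d2)) * (a * c ^+ 2 * d2) by rewrite /S; ring.
  exact/(slide_perp_x1 EP)/x1z/zz/Pz/IMr.
Qed.

Lemma slide_factor_in I G H w : elementary_pair I G H -> ideal I ->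
  perp_ef w -> inIM I w -> H (slide (slide_factor *: w)).
Proof.
move=> EP idI Pw [k [i [m [Ii wE]]]].
(* The vectors in an expression of [w] as an [I]-combination need not be orthogonal to [e] and [f];
   the projection [pr] makes them so and fixes [w]. *)
pose pr x := x - C f x *: e - C e x *: f.
have Ppr x : perp_ef (pr x) by split; rewrite /pr !bformE ?(ee, ff, ef, fe); ring.
have {wE}-> : w = \sum_(j < k) i j *: pr (m j).
  have {1}-> : w = pr w.
    by rewrite /pr (proj1 Pw) (proj2 Pw) !scale0r !subr0.
  rewrite [in LHS]wE; elim/big_rec2: _ => [|j y z _ yE].
    by rewrite /pr !bform0r // !scale0r !subr0.
  rewrite -yE; apply: form_ext => t.
  by rewrite /pr !bformE; ring.
rewrite scaler_sumr.
elim: k i m Ii => [|k IH] i m Ii.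
  rewrite big_ord0; apply: (sg_ext (ep_H EP) _ (sg_id (ep_H EP))) => x.
  by rewrite /slide scaler0 bform0r // scale0r subr0 eichler0.
rewrite big_ord_recl.
have H1 : H (slide (slide_factor *: (i ord0 *: pr (m ord0)))).
  by rewrite scalerA mulrC; apply: slide_scale EP idI _ _.
have {}IH := IH (fun j => i (lift ord0 j)) (fun j => m (lift ord0 j)) (fun j => Ii _).
apply: (sg_ext (ep_H EP) _ (sg_comp (ep_H EP) H1 IH)) => x /=.
rewrite -slideD //; first exact/perp_efZ/perp_efZ.
elim/big_ind: _ => [|u' v|j _]; first by split; rewrite bform0r.
- exact: perp_efD.
- exact/perp_efZ/perp_efZ.
Qed.

End Slide.

(** * Multipliers outside a maximal ideal *)

Section Localize.
Variables (I : R -> Prop) (G H : (M -> M) -> Prop).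
Hypotheses (EP : elementary_pair I G H) (idI : ideal I).

(** For [w = a (v - c e - d f) - c p], the second argument of [T(w)] plus [a c u] is [a^2 v], and
    [eichler_addl] ignores multiples of [u]. This contributes [a^2] besides [slide_factor]. *)
Lemma eichler_factor_in (u v x1 y1 x2 y2 : M) (d1 d2 : R) :
    C u u = 0 -> C u v = 0 -> inIM I v ->
    perp_ef x1 -> perp_ef y1 -> perp_ef x2 -> perp_ef y2 ->
    hyperbolic_pairs d1 d2 x1 y1 x2 y2 ->
  H (eichler u ((C f u ^+ 2 * ((C f u * C u x1 * d2) ^+ 2 * (d1 * d2 ^+ 2))) *: v)).
Proof.
move=> uu uv Iv Px1 Py1 Px2 Py2 hyp.
have fe : C f e = 1 by rewrite bformC.
have [a aE] : exists a, a = C f u by eexists.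
have [b bE] : exists b, b = C e u by eexists.
have [p pE] : exists p, p = u - a *: e - b *: f by eexists.
have uE : u = a *: e + b *: f + p.
  by apply: form_ext => t; rewrite pE !bformE; ring.
have Pp : perp_ef p.
  by split; rewrite pE !bformE -?(aE, bE) ?(ee, ff, ef, fe); ring.
have ux1 : C u x1 = C p x1.
  by rewrite pE !bformE (proj1 Px1) (proj2 Px1); ring.
rewrite -aE ux1 -/(slide_factor a p d1 d2 x1).
set s := slide_factor _ _ _ _ _.
have [c cE] : exists c, c = C f v by eexists.
have [d dE] : exists d, d = C e v by eexists.
have [w wE] : exists w, w = a *: (v - c *: e - d *: f) - c *: p by eexists.
have [[ep fp] pe pf] : [/\ perp_ef p, C p e = 0 & C p f = 0].
  by case: Pp => ep fp; split=> //; rewrite bformC.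
have Pw : perp_ef w.
  by split; rewrite wE !bformE -?(cE, dE) ?(ee, ff, ef, fe, ep, fp); ring.
have Iw : inIM I w.
  have Ic : I c by rewrite cE bformC; apply: inIM_form idI bilC Iv.
  have Id : I d by rewrite dE bformC; apply: inIM_form idI bilC Iv.
  rewrite wE; apply: inIMD; last by apply/inIMN/inIM_scale.
  apply/inIMZ/inIMD; last by apply/inIMN/inIM_scale.
  by apply: inIMD => //; apply/inIMN/inIM_scale.
apply: (sg_ext (ep_H EP) _ (slide_factor_in Pp uE uu Px1 Py1 Px2 Py2 hyp EP idI Pw Iw)).
move=> m; rewrite -/s /slide.
have up : C p v = - (a * d + b * c).
  by apply/eqP; rewrite -subr_eq0; apply/eqP; rewrite -uv uE !bformE -cE -dE; ring.
have pp : C p p = - (a * b + a * b).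
  apply/eqP; rewrite -subr_eq0; apply/eqP; rewrite -uu uE !bformE.
  by rewrite ee ff ef fe ep fp pe pf; ring.
rewrite -[LHS](eichler_addl (s * (a * c))) //; last first.
  by apply: (slide_perp Pp uE); apply: perp_efZ.
congr eichler; apply: form_ext => t.
by rewrite wE !bformE up pp pe pf uE !bformE; ring.
Qed.

Definition locally_in (m : R -> Prop) (u : M) : Prop :=
  exists s, ~ m s /\ forall v, inIM I v -> C u v = 0 -> H (eichler u (s *: v)).

(** Since [G] normalizes [H], the vector [u] may be moved by [E(x, y)] before a multiplier is
    sought. *)
Lemma locally_in_conj m u x y : C x x = 0 -> C x y = 0 -> G (eichler x y) ->
  locally_in m (eichler x y u) -> locally_in m u.
Proof.
move=> xx xy Gxy [s [ms Hs]]; exists s; split=> // v Iv uv.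
have gK := eichlerK xx xy; have g'K := eichlerVK xx xy.
have gg i j : C (eichler x y i) (eichler x y j) = C i j by apply: eichler_isometry.
have lg := eichler_linear x y.
have Hg := Hs (eichler x y v) (inIM_linear lg Iv) (etrans (gg _ _) uv).
have Gg' := sg_inv (ep_G EP) Gxy gK g'K.
apply: (sg_ext (ep_H EP) _ (ep_normal EP Gg' g'K gK Hg)) => n /=.
have -> : s *: eichler x y v = eichler x y (s *: v).
  by apply: form_ext => t; rewrite /eichler !bformE; ring.
by rewrite -(eichler_conj _ _ _ lg g'K gg) !gK.
Qed.

Variables (m : R -> Prop) (x1 y1 x2 y2 : M) (d1 d2 : R).
Hypotheses (prm : prime_ideal m) (md1 : ~ m d1) (md2 : ~ m d2).
Hypotheses (Px1 : perp_ef x1) (Py1 : perp_ef y1) (Px2 : perp_ef x2) (Py2 : perp_ef y2).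
Hypothesis hyp : hyperbolic_pairs d1 d2 x1 y1 x2 y2.

Let mX x k : ~ m x -> ~ m (x ^+ k).
Proof.
move=> mx; elim: k => [|k IH]; first exact: prime_ideal_proper prm.
by rewrite exprS; apply: prime_idealM prm _ _ mx IH.
Qed.

Let m_sum x y : m x -> ~ m y -> ~ m (x + y).
Proof.
case: prm => -[_ [mD mM]] _ _ mx my mxy; apply: my.
have -> : y = (x + y) + (-1) * x by ring.
by apply: (mD) => //; apply: mM.
Qed.

Let fe : C f e = 1. Proof. by rewrite bformC. Qed.

Lemma locally_in_coord_x1 u : C u u = 0 -> ~ m (C f u) -> ~ m (C u x1) -> locally_in m u.
Proof.
move=> uu ma mc; eexists; split; last first.
  by move=> v Iv uv; apply: (eichler_factor_in uu uv Iv Px1 Py1 Px2 Py2 hyp).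
by do !(apply: (prime_idealM prm) || apply: mX).
Qed.

(** If [C u x1] lies in [m], then [E(f, y1)] keeps [C f u] and subtracts from [C u x1] the scalar
    [C f u * d1], which is outside [m]. *)
Lemma locally_in_coord u : C u u = 0 -> ~ m (C f u) -> locally_in m u.
Proof.
move=> uu ma; have [mc|] := pselect (m (C u x1)); last exact: locally_in_coord_x1.
have [[_ fx1] [_ fy1]] := (Px1, Py1).
apply: (@locally_in_conj m u f y1) => //; first by case: (ep_genG EP Py1).
apply: locally_in_coord_x1; first by rewrite eichler_isometry.
  by rewrite /eichler !bformE fy1 ff !(mulr0, addr0, subr0).
have -> : C (eichler f y1 u) x1 = C u x1 + - 1 * (C f u * d1).
  rewrite /eichler !bformE fx1 (bformC y1 x1) (hp_x1y1 hyp); ring.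
apply: m_sum => //; apply: (prime_idealM prm); last exact: (prime_idealM prm).
have [_ [_ mM]] := prime_is_ideal prm.
by move=> /(mM (-1)); rewrite mulN1r opprK; apply: (prime_ideal_proper prm).
Qed.

(** It remains to move [C f u] outside [m], and [E(e, y)] adds [C y u - h * C y y * C e u] to it. An
    isotropic [y] with [C y u] outside [m] suffices. If there is none, [hyperbolic_pairs_span] puts
    every [C y u] in [m], so [C e u] is outside [m] because [u] pairs to 1 with [w]; then
    [y = x1 + y1] works, as [h * C y y = d1]. *)
Lemma eichler_locally_in u : C u u = 0 -> (exists w, C u w = 1) -> locally_in m u.
Proof.
move=> uu [w uw]; have [ma|] := pselect (m (C f u)); last exact: locally_in_coord.
have [m0 [mD mM]] := prime_is_ideal prm.
have coord y : C f (eichler e y u) = C f u + (C y u - h * C y y * C e u) - C e u * C f y.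
  by rewrite /eichler !bformE fe; ring.
have move_e y : perp_ef y -> ~ m (C y u - h * C y y * C e u) -> locally_in m u.
  move=> Py my; have [ey fy] := Py.
  apply: (@locally_in_conj m u e y) => //; first by case: (ep_genG EP Py).
  apply: locally_in_coord; first by rewrite eichler_isometry.
  by rewrite coord fy mulr0 subr0; apply: m_sum.
have [[y [Py yy my]]|noiso] :=
    pselect (exists y, [/\ perp_ef y, C y y = 0 & ~ m (C y u)]).
  by apply: (move_e y) => //; rewrite yy mulr0 mul0r subr0.
have iso_m y : perp_ef y -> C y y = 0 -> m (C y u).
  by move=> Py yy; apply: contrapT => my; apply: noiso; exists y.
have perp_m y : perp_ef y -> m (C y u).
  move=> Py; have: m (C ((d1 * d2 ^+ 2) *: y) u).
    apply: (hyperbolic_pairs_span (V := perp_ef) (K := fun z => m (C z u)) hyp) => //.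
    - exact: perp_efD.
    - exact: perp_efZ.
    - by move=> z z' _ _ mz mz'; rewrite bformDl //; apply: mD.
    - by move=> l; rewrite bformZl //; apply/mM/iso_m/(hp_x1x1 hyp).
    - by move=> l; rewrite bformZl //; apply/mM/iso_m/(hp_y1y1 hyp).
    - by move=> z Pz zz _ _; apply: iso_m.
  rewrite bformZl // => md; apply: contrapT => my; move: md.
  by apply: (prime_idealM prm) => //; apply: (prime_idealM prm) => //; apply: mX.
have mb : ~ m (C e u).
  move=> mb; apply: (prime_ideal_proper prm); rewrite -uw.
  have -> : C u w = C f w * C e u + C e w * C f u
      + C (w - C f w *: e - C e w *: f) u.
    by rewrite !bformE (bformC w u); ring.
  apply: (mD); first by apply: (mD); apply: (mM).
  by apply: perp_m; split; rewrite !bformE ?(ee, ff, ef, fe); ring.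
apply: (move_e (x1 + y1)); first exact: perp_efD.
have -> : C (x1 + y1) u - h * C (x1 + y1) (x1 + y1) * C e u
    = C (x1 + y1) u + (- 1) * (d1 * C e u).
  rewrite !bformE (hp_x1x1 hyp) (hp_y1y1 hyp) (bformC y1 x1) (hp_x1y1 hyp).
  by apply: (@eq_mod_half (- (d1 * C e u))); ring.
apply: m_sum; first exact/perp_m/perp_efD.
apply: (prime_idealM prm); last exact: (prime_idealM prm).
by move=> /(mM (-1)); rewrite mulN1r opprK; apply: (prime_ideal_proper prm).
Qed.

End Localize.

Lemma eichler_in I G H u v : elementary_pair I G H -> ideal I ->
    (forall m, maximal_ideal m -> exists d1 d2 x1 y1 x2 y2, [/\ ~ m d1, ~ m d2,
      [/\ perp_ef x1, perp_ef y1, perp_ef x2 & perp_ef y2] &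
      hyperbolic_pairs d1 d2 x1 y1 x2 y2]) ->
    C u u = 0 -> (exists w, C u w = 1) -> inIM I v -> C u v = 0 ->
  H (eichler u v).
Proof.
move=> EP idI pairs uu uw Iv uv.
pose J l := forall v, inIM I v -> C u v = 0 -> H (eichler u (l *: v)).
suff J1 : J 1 by rewrite -[v]scale1r; apply: J1.
have sH := ep_H EP.
apply: ideal_local_global => [|m mm].
  split=> [w _ _|].
    apply: (sg_ext sH _ (sg_id sH)) => x.
    by rewrite scale0r eichler0.
  split=> [l k Jl Jk w Iw uw'|r l Jl w Iw uw'].
    apply: (sg_ext sH _ (sg_comp sH (Jl w Iw uw') (Jk w Iw uw'))) => x /=.
    by rewrite scalerDl eichlerD // bformZr // uw' mulr0.
  rewrite mulrC -scalerA; apply: Jl; first exact: inIMZ.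
  by rewrite bformZr // uw' mulr0.
have [d1 [d2 [x1 [y1 [x2 [y2 [md1 md2 [Px1 Py1 Px2 Py2] hyp]]]]]]] := pairs m mm.
exact: (eichler_locally_in EP idI (maximal_prime mm) md1 md2 Px1 Py1 Px2 Py2 hyp uu uw).
Qed.

End Bilinear.

(** * Hyperbolic pairs from a local splitting *)

Section Congruence.
Variables (R : comPzRingType) (m : R -> Prop).
Hypothesis prm : prime_ideal m.

Lemma common_denominator k (Q : 'I_k -> R -> Prop) :
    (forall i, exists s, ~ m s /\ Q i s) ->
    (forall i s t, Q i s -> Q i (t * s)) ->
  exists s, ~ m s /\ forall i, Q i s.
Proof.
move=> /fin_all_exists [S QS] QM; exists (\prod_i S i); split; last first.
  by move=> i; rewrite (bigD1 i) //= mulrC; apply: QM; case: (QS i).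
apply: (big_ind (fun x => ~ m x)); first exact: prime_ideal_proper prm.
  exact: (prime_idealM prm).
by move=> i _; case: (QS i).
Qed.

Lemma det_congr k (A D : 'M[R]_k) :
  (forall i j, m (A i j - D i j)) -> m (\det A - \det D).
Proof.
have [m0 [mD mM]] := prime_is_ideal prm => AD.
rewrite /determinant -sumrB; apply: (big_ind (fun x => m x)) => // s _.
rewrite -mulrBr; apply: (mM).
apply: (big_ind2 (fun x y => m (x - y))) => [|x x' y y' xx' yy'|i _]; last exact: AD.
  by rewrite subrr.
have -> : x * y - x' * y' = y * (x - x') + x' * (y - y') by ring.
by apply: (mD); apply: (mM).
Qed.

(** Modulo [m] the matrix is [t] times the identity, so its determinant is congruent to [t ^+ k] and
    lies outside [m]. The adjugate then turns the relations into [\det A *: n i] being a multiple of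
    [x]. *)
Lemma nakayama_det (M : lmodType R) k (A : 'M[R]_k) (t : R) (n : 'I_k -> M) (x : M) :
    ~ m t -> (forall i j, m (A i j - t *+ (i == j))) ->
    (forall i, exists r, \sum_j A i j *: n j = r *: x) ->
  exists s, ~ m s /\ forall i, exists r, s *: n i = r *: x.
Proof.
move=> mt At /fin_all_exists [r rE]; exists (\det A); split.
  have [m0 [mD mM]] := prime_is_ideal prm => mA.
  have := @det_congr _ A t%:M; rewrite det_scalar => detA.
  have: m (t ^+ k).
    have -> : t ^+ k = \det A + (-1) * (\det A - t ^+ k) by ring.
    apply: (mD) => //; apply: (mM); apply: detA => i j; rewrite mxE; exact: At.
  elim: (k) => [|l IH]; first exact: (prime_ideal_proper prm).
  by rewrite exprS => mtl; apply: (prime_idealM prm mt _ mtl).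
move=> i; exists (\sum_l \adj A i l * r l).
have -> : (\sum_l \adj A i l * r l) *: x =
    \sum_l \sum_j (\adj A i l * A l j) *: n j.
  rewrite scaler_suml; apply: eq_bigr => l _; rewrite -scalerA -rE scaler_sumr.
  by apply: eq_bigr => j _; rewrite scalerA.
rewrite exchange_big /=.
under eq_bigr => j _ do rewrite -scaler_suml.
rewrite (bigD1 i) //= [X in _ + X]big1 ?addr0.
  by have /matrixP/(_ i i) := mul_adj_mx A; rewrite mxE [RHS]mxE eqxx mulr1n => ->.
move=> j ji; have /matrixP/(_ i j) := mul_adj_mx A; rewrite mxE [RHS]mxE => ->.
by rewrite eq_sym (negbTE ji) scale0r.
Qed.

End Congruence.

(** * Submodules and freeness of the localization in terms of numerators *)

Section Numerators.
Variables (R : comPzRingType) (P : lmodType R) (m : R -> Prop).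
Hypothesis prm : prime_ideal m.

Let m1 : ~ m 1 := prime_ideal_proper prm.
Let mMn x y : ~ m x -> ~ m y -> ~ m (x * y). Proof. exact: (prime_idealM prm). Qed.

Lemma locSub_num (N : P * R -> Prop) x s :
  locSub m N -> ~ m s -> N (x, s) -> N (x, 1).
Proof.
move=> [NE [N0 [ND NZ]]] ms Nxs.
apply: (NE (locscale (s, 1) (x, s)) (x, 1)); [exact: mMn|exact: m1| |].
  by exists 1; split=> //=; rewrite mul1r !scale1r subrr.
exact: (NZ (s, 1) (x, s) m1 ms Nxs).
Qed.

Lemma locSub_numD (N : P * R -> Prop) x y :
  locSub m N -> N (x, 1) -> N (y, 1) -> N (x + y, 1).
Proof.
move=> [_ [_ [ND _]]] Nx Ny.
by have := ND (x, 1) (y, 1) m1 m1 Nx Ny; rewrite /locadd /= !scale1r mul1r.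
Qed.

Lemma locSub_numZ (N : P * R -> Prop) a x :
  locSub m N -> N (x, 1) -> N (a *: x, 1).
Proof.
move=> [_ [_ [_ NZ]]] Nx.
by have := NZ (a, 1) (x, 1) m1 m1 Nx; rewrite /locscale /= mul1r.
Qed.

Lemma foldr_locadd k (s : 'I_k -> R) (x : 'I_k -> P) (l : seq 'I_k) :
  foldr (@locadd R P) loczero [seq (s i *: x i, s i) | i <- l] =
  ((\prod_(i <- l) s i) *: (\sum_(i <- l) x i), \prod_(i <- l) s i).
Proof.
elim: l => [|i l IH] /=; first by rewrite !big_nil scaler0.
rewrite IH !big_cons /locadd /= scalerDr !scalerA.
by rewrite [(\prod_(_ <- _) _) * s i]mulrC.
Qed.

Lemma loc_free_rank_free r : loc_free_rank P m r ->
  exists E : 'I_r -> P, forall k : 'I_r -> R, \sum_i k i *: E i = 0 ->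
    forall i, exists u, ~ m u /\ u * k i = 0.
Proof.
move=> [e [ve [_ free]]]; exists (fun i => (e i).1) => k k0 i.
(* The factor [(e j).2] cancels the denominator of [e j]. *)
pose c j := (k j * (e j).2, 1 : R).
have cv j : ~ m (c j).2 by exact: m1.
have [|u [mu]] := free c cv _ i.
  exists 1; split=> //.
  have -> : locsum (fun j => locscale (c j) (e j)) =
      foldr (@locadd R P) loczero [seq ((e j).2 *: (k j *: (e j).1), (e j).2) | j <- enum 'I_r].
    by congr foldr; apply: eq_map => j; rewrite /locscale /= mul1r scalerA mulrC.
  have kE : \sum_(j <- enum 'I_r) k j *: (e j).1 = 0.
    by rewrite -[RHS]k0 big_enum; apply: eq_bigl.
  by rewrite foldr_locadd kE /= !scaler0 subrr scaler0.
rewrite /= /GRing.scale /= mulr0 subr0 mul1r => uk.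
exists (u * (e i).2); split; first exact/mMn/ve.
by rewrite -uk; ring.
Qed.

(** Three independent vectors would be locally combinations of [x] and [y]. The relation with the 2
    by 2 minors as coefficients kills [d] up to a scalar outside [m]. Relations between the first
    two vectors then kill [a1] and [b1], hence a multiple of the first vector, and 0 would lie
    outside [m]. *)
Lemma rank3_not_rank2 r (x y : P) : loc_free_rank P m r.+3 ->
  ~ (forall p, exists s, ~ m s /\ exists a b, s *: p = a *: x + b *: y).
Proof.
move=> /loc_free_rank_free [E free] gen.
have [i1 [i2 [i3 ind]]] : exists i1 i2 i3, forall k1 k2 k3,
    k1 *: E i1 + k2 *: E i2 + k3 *: E i3 = 0 ->
    [/\ exists u, ~ m u /\ u * k1 = 0, exists u, ~ m u /\ u * k2 = 0
      & exists u, ~ m u /\ u * k3 = 0].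
  exists ord0, (lift ord0 ord0), (lift ord0 (lift ord0 ord0)) => k1 k2 k3 k0.
  pose k (i : 'I_r.+3) := nth 0 [:: k1; k2; k3] (nat_of_ord i).
  have kE : \sum_i k i *: E i = 0.
    rewrite !big_ord_recl big1 ?addr0 ?addrA // => i _.
    by rewrite /k /= nth_nil scale0r.
  split; [have := free k kE ord0|have := free k kE (lift ord0 ord0)
    |have := free k kE (lift ord0 (lift ord0 ord0))]; by [].
have [s1 [ms1 [a1 [b1 e1]]]] := gen (E i1).
have [s2 [ms2 [a2 [b2 e2]]]] := gen (E i2).
have [s3 [ms3 [a3 [b3 e3]]]] := gen (E i3).
pose d := a1 * b2 - a2 * b1.
have lin2 A B A' B' : A *: x + B *: y + (A' *: x + B' *: y) = (A + A') *: x + (B + B') *: y.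
  by rewrite !scalerDl addrACA.
have lin0 A B : A = 0 -> B = 0 -> A *: x + B *: y = 0.
  by move=> -> ->; rewrite !scale0r addr0.
have [_ _ [u3 [mu3 u3d]]] : [/\ exists u, ~ m u /\ u * ((a2 * b3 - a3 * b2) * s1) = 0,
    exists u, ~ m u /\ u * ((a3 * b1 - a1 * b3) * s2) = 0
  & exists u, ~ m u /\ u * (d * s3) = 0].
  apply: ind; rewrite -!scalerA e1 e2 e3 !scalerDr !scalerA.
  by rewrite !lin2 lin0 // /d; ring.
have [w [mw wd]] : exists w, ~ m w /\ w * d = 0.
  by exists (u3 * s3); split; [exact: mMn|rewrite -u3d; ring].
have [_ [u2 [mu2 u2a]] _] : [/\ exists u, ~ m u /\ u * (w * a2 * s1) = 0,
    exists u, ~ m u /\ u * (- (w * a1) * s2) = 0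
  & exists u, ~ m u /\ u * 0 = 0 :> R].
  apply: ind; rewrite -!scalerA e1 e2 scale0r addr0 !scalerDr !scalerA lin2.
  by apply: lin0; [ring|apply: oppr_inj; rewrite oppr0 -[RHS]wd /d; ring].
have [_ [u1 [mu1 u1b]] _] : [/\ exists u, ~ m u /\ u * (w * b2 * s1) = 0,
    exists u, ~ m u /\ u * (- (w * b1) * s2) = 0
  & exists u, ~ m u /\ u * 0 = 0 :> R].
  apply: ind; rewrite -!scalerA e1 e2 scale0r addr0 !scalerDr !scalerA lin2.
  by apply: lin0; [rewrite -[RHS]wd /d; ring|ring].
pose t := u1 * u2 * w * s2.
have mt : ~ m t by do !apply: mMn.
have [[u [mu ut]] _ _] : [/\ exists u, ~ m u /\ u * (t * s1) = 0,
  exists u, ~ m u /\ u * 0 = 0 :> R & exists u, ~ m u /\ u * 0 = 0 :> R].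
  apply: ind; rewrite -scalerA e1 !scale0r !addr0 scalerDr !scalerA.
  have -> : t * a1 = - (u1 * (u2 * (- (w * a1) * s2))) by rewrite /t; ring.
  have -> : t * b1 = - (u2 * (u1 * (- (w * b1) * s2))) by rewrite /t; ring.
  by rewrite u2a u1b !mulr0 oppr0 !scale0r addr0.
have : ~ m (u * (t * s1)) by do !apply: mMn.
by rewrite ut; apply; case: (prime_is_ideal prm).
Qed.

End Numerators.

(** * Construction of the two pairs *)

Section LocalHyperbolicPairs.
Variables (R : comPzRingType) (P : lmodType R) (B : P -> P -> R) (m : R -> Prop).
Hypotheses (orthB : orthogonal_module B) (prm : prime_ideal m).

Let bilB : sym_bilinear B := proj1 (proj2 orthB).
Let mMn x y : ~ m x -> ~ m y -> ~ m (x * y). Proof. exact: (prime_idealM prm). Qed.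

(* If all these minors lie in [m], Nakayama's lemma makes the Lagrangian [N] locally cyclic,
   and then [P] is locally generated by two elements. *)
Lemma split_minor r : loc_free_rank P m r.+3 -> split_at m B ->
  exists x1 x2 y1 y2 u, [/\ ~ m u, ~ m (B x1 y1 * B x2 y2 - B x1 y2 * B x2 y1) &
    [/\ u * B x1 x1 = 0, u * B x1 x2 = 0 & u * B x2 x2 = 0]].
Proof.
move=> rk [N [[sN [C [sC [dec disj]]]] perp]].
have [[m0 [mD mM]] m1] := (prime_is_ideal prm, prime_ideal_proper prm).
pose N0 x := N (x, 1); pose C0 x := C (x, 1).
have N0D x y : N0 x -> N0 y -> N0 (x + y) := @locSub_numD _ _ _ prm N x y sN.
have N0Z a x : N0 x -> N0 (a *: x) := @locSub_numZ _ _ _ prm N a x sN.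
have C0D x y : C0 x -> C0 y -> C0 (x + y) := @locSub_numD _ _ _ prm C x y sC.
have C0Z a x : C0 x -> C0 (a *: x) := @locSub_numZ _ _ _ prm C a x sC.
have N0N x : N0 x -> N0 (- x) by rewrite -scaleN1r; apply: N0Z.
have dec0 p : exists s, ~ m s /\ exists n c, [/\ N0 n, C0 c & s *: p = n + c].
  have [[y ys] [[z zs] [mys [mzs [Ny [Cz [u [mu]]]]]]]] := dec (p, 1) m1.
  rewrite /locadd /= scale1r => uE.
  exists (u * (ys * zs)); split; first by do !apply: mMn.
  exists ((u * zs) *: y), ((u * ys) *: z); split.
  - exact/N0Z/(locSub_num prm sN mys).
  - exact/C0Z/(locSub_num prm sC mzs).
  by move: uE => /eqP; rewrite scalerBr subr_eq0 scalerDr !scalerA => /eqP.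
have disj0 p : N0 p -> C0 p -> exists u, ~ m u /\ u *: p = 0.
  move=> Np Cp; have [u [mu]] := disj (p, 1) m1 Np Cp.
  by rewrite /= scaler0 subr0 scale1r; exists u.
have perpN x y : N0 x -> N0 y -> exists u, ~ m u /\ u * B x y = 0.
  move=> /perp-/(_ m1) Nx Ny; have [u [mu]] := Nx (y, 1) m1 Ny.
  by rewrite /= scaler0 subr0 scale1r; exists u.
have Nperp x : (forall y, N0 y -> exists u, ~ m u /\ u * B x y = 0) -> N0 x.
  move=> xN; apply/(perp (x, 1) m1) => -[y s] ms Ny.
  have [u [mu uxy]] := xN y (locSub_num prm sN ms Ny).
  by exists u; split=> //; rewrite /= scaler0 subr0 scale1r.
apply: contrapT => nominor.
have minor x1 x2 y1 y2 : N0 x1 -> N0 x2 -> m (B x1 y1 * B x2 y2 - B x1 y2 * B x2 y1).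
  move=> N1 N2; apply: contrapT => mn; apply: nominor.
  have [u11 [mu11 e11]] := perpN x1 x1 N1 N1.
  have [u12 [mu12 e12]] := perpN x1 x2 N1 N2.
  have [u22 [mu22 e22]] := perpN x2 x2 N2 N2.
  exists x1, x2, y1, y2, (u11 * u12 * u22); split=> //; first by do !apply: mMn.
  split.
  - by transitivity (u12 * u22 * (u11 * B x1 x1)); [ring|rewrite e11 mulr0].
  - by transitivity (u11 * u22 * (u12 * B x1 x2)); [ring|rewrite e12 mulr0].
  - by transitivity (u11 * u12 * (u22 * B x2 x2)); [ring|rewrite e22 mulr0].
(* If some pairing with [N] is outside [m], it serves as [d]. Otherwise [x1 = 0], [y1 = 0], [d = 1]
   satisfy the same conditions, and both cases continue together. *)
have [x1 [y1 [d [Nx1 md small orth]]]] : exists x1 y1 d, [/\ N0 x1, ~ m d,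
    forall n, N0 n -> forall y, m (B (d *: n - B n y1 *: x1) y)
  & forall p, B x1 (d *: p - B p x1 *: y1) = 0].
  have [[x1 [y1 [Nx1 mxy]]]|no] := pselect (exists x1 y1, N0 x1 /\ ~ m (B x1 y1)).
    exists x1, y1, (B x1 y1); split=> // [n Nn y|p].
      have -> : B (B x1 y1 *: n - B n y1 *: x1) y = B x1 y1 * B n y - B x1 y * B n y1.
        by rewrite !(bformE bilB); ring.
      exact: minor.
    by rewrite !(bformE bilB) (bformC bilB p); ring.
  exists 0, 0, 1; split=> // [|n Nn y|p]; first by case: sN => _ [].
    rewrite scaler0 subr0 scale1r; apply: contrapT => mny; apply: no.
    by exists n, y.
  by rewrite bform0l.
have [[k [f [g [lf [lg fg]]]]] _] := orthB.
pose b l := g (delta_mx 0 l).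
have basis p : p = \sum_l f p 0 l *: b l.
  have g0 : g 0 = 0.
    have := lg 1 0 0; rewrite scaler0 add0r scale1r => /esym gg.
    by apply: (addrI (g 0)); rewrite gg addr0.
  rewrite -{1}(fg p) [f p in LHS]row_sum_delta.
  apply: (big_ind2 (fun v q => g v = q)) => // [v q v' q' <- <-|l _].
    by rewrite -[v]scale1r lg !scale1r.
  by rewrite -[_ *: _]addr0 lg g0 addr0.
(* By non-degeneracy each coordinate is a pairing with some [q], so a vector that pairs into [m] has
   coordinates in [m]. *)
have coord_m p l : (forall y, m (B p y)) -> m (f p 0 l).
  move=> mp; have [|q qE] := proj2 (proj2 (proj2 orthB)) (fun p => f p 0 l).
    by move=> a x y; rewrite lf !mxE.
  by rewrite qE bformC.
have [s [ms sb]] : exists s, ~ m s /\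
    forall l, exists n c, [/\ N0 n, C0 c & s *: b l = n + c].
  apply: (common_denominator prm) => [l|l s t [n [c [Nn Cc E]]]]; first exact: dec0.
  by exists (t *: n), (t *: c); rewrite -scalerA E scalerDr; split; auto.
have [n nE] := fin_all_exists sb.
have {sb nE} [c ncE] := fin_all_exists nE.
have Nn l : N0 (n l) by case: (ncE l).
have N0sum (F : 'I_k -> P) : (forall l, N0 (F l)) -> N0 (\sum_l F l).
  by move=> NF; apply: (big_ind N0) => //; case: sN => _ [].
have C0sum (F : 'I_k -> P) : (forall l, C0 (F l)) -> C0 (\sum_l F l).
  by move=> NF; apply: (big_ind C0) => //; case: sC => _ [].
(* The [N]-components [n l] of the generators span [N] locally: the difference lies in both [N] and
   its complement. *)
have gen x : N0 x -> exists u, ~ m u /\ (u * s) *: x = u *: \sum_l f x 0 l *: n l.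
  move=> Nx; have [|| u [mu uE]] := disj0 (s *: x - \sum_l f x 0 l *: n l).
  - by apply: N0D; [exact: N0Z|apply/N0N/N0sum => l; apply: N0Z].
  - have -> : s *: x - \sum_l f x 0 l *: n l = \sum_l f x 0 l *: c l.
      rewrite {1}(basis x) scaler_sumr -sumrB; apply: eq_bigr => l _.
      have [_ _ sE] := ncE l.
      by rewrite scalerA mulrC -scalerA sE -scalerBr addrC addKr.
    by apply: C0sum => l; apply: C0Z; case: (ncE l).
  exists u; split=> //; apply/eqP.
  by rewrite -subr_eq0 -scalerA -scalerBr uE.
pose n' l := d *: n l - B (n l) y1 *: x1.
have Nn' l : N0 (n' l) by apply: N0D; [exact: N0Z|apply/N0N/N0Z].
have [u [mu un']] : exists u, ~ m u /\
    forall l, (u * s) *: n' l = u *: \sum_j f (n' l) 0 j *: n j.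
  apply: (common_denominator prm) => [l|l u t E]; first exact: gen.
  by rewrite -mulrA -scalerA E scalerA.
(* The coordinates of [n' i] lie in [m], so [A] is scalar modulo [m]; replacing [n j] by [n' j] in
   the relations costs only multiples of [x1]. *)
pose A := \matrix_(i, j) ((u * s * d) *+ (i == j) - u * f (n' i) 0 j).
have [||i|e [me eE]] := @nakayama_det _ _ prm P k A (u * s * d) n' x1.
- by do !apply: mMn.
- move=> i j; rewrite mxE addrAC subrr add0r -mulNr; apply: (mM).
  by apply: coord_m; apply: small.
- exists (u * \sum_j f (n' i) 0 j * B (n j) y1).
  have -> : \sum_j A i j *: n' j = (u * s * d) *: n' i - u *: \sum_j f (n' i) 0 j *: n' j.
    under eq_bigr => j _ do rewrite mxE scalerBl.
    rewrite sumrB scaler_sumr; congr (_ - _); last first.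
      by apply: eq_bigr => j _; rewrite scalerA.
    rewrite (bigD1 i) //= eqxx mulr1n big1 ?addr0 // => j ji.
    by rewrite eq_sym (negbTE ji) scale0r.
  rewrite mulrC -scalerA un' scalerA mulrC -!scalerA -scalerBr; congr (_ *: _).
  rewrite scaler_sumr -sumrB scaler_suml; apply: eq_bigr => j _.
  rewrite /n' scalerBr !scalerA opprB addrCA [d * _]mulrC subrr addr0.
  by [].
have Ncyc x : N0 x -> exists w, ~ m w /\ exists r, w *: x = r *: x1.
  move=> Nx; have [w [mw wE]] := gen x Nx.
  exists (e * d * (w * s)); split; first by do !apply: mMn.
  have ned l : exists r, (e * d) *: n l = r *: x1.
    have [q qE] := eE l; exists (q + e * B (n l) y1).
    by rewrite scalerDl -qE /n' scalerBr !scalerA subrK.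
  have [q qE] := fin_all_exists ned.
  exists (w * \sum_l f x 0 l * q l).
  rewrite -scalerA wE scalerA [e * d * w]mulrC -!(scalerA w); congr (_ *: _).
  rewrite scaler_sumr scaler_suml; apply: eq_bigr => l _.
  by rewrite -[in RHS]scalerA -qE !scalerA; congr (_ *: _); ring.
(* The vector [d p - B p x1 y1] is orthogonal to [x1], hence to the locally cyclic [N], and so lies
   in [N]. Thus [x1] and [y1] generate [P] locally. *)
apply: (rank3_not_rank2 prm (x := x1) (y := y1) rk) => p.
have [|w [mw [q qE]]] := Ncyc (d *: p - B p x1 *: y1).
  apply: Nperp => y Ny; have [w [mw [q qE]]] := Ncyc y Ny.
  exists w; split=> //; rewrite -(bformZr bilB) qE (bformZr bilB) (bformC bilB) orth.
  by rewrite mulr0.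
exists (w * d); split; first exact: mMn.
exists q, (w * B p x1).
by rewrite -qE scalerBr !scalerA subrK.
Qed.

Variable h : R.
Hypothesis half : 2%:R * h = 1.

(** Cramer's rule gives [Y1], [Y2] dual to [X1], [X2] up to [D]. Multiples of [X1] and [X2] make
    them isotropic, and a further multiple of [X1] makes the second orthogonal to the first. *)
Lemma local_hyperbolic_pairs r : loc_free_rank P m r.+3 -> split_at m B ->
  exists d1 d2 x1 y1 x2 y2,
    [/\ ~ m d1, ~ m d2 & hyperbolic_pairs B d1 d2 x1 y1 x2 y2].
Proof.
move=> rk sp; have [x1 [x2 [y1 [y2 [u [mu mD [u11 u12 u22]]]]]]] := split_minor rk sp.
pose E := bformE bilB.
have BC := bformC bilB.
have [X1 X1E] : exists X, X = u *: x1 by eexists.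
have [X2 X2E] : exists X, X = u *: x2 by eexists.
have [D DE] : exists D, D = B X1 y1 * B X2 y2 - B X1 y2 * B X2 y1 by eexists.
have mDD : ~ m D.
  have -> : D = u * (u * (B x1 y1 * B x2 y2 - B x1 y2 * B x2 y1)).
    by rewrite DE X1E X2E !E; ring.
  by do !apply: mMn.
have X11 : B X1 X1 = 0 by rewrite X1E !E u11 mulr0.
have X12 : B X1 X2 = 0 by rewrite X1E X2E !E u12 mulr0.
have X22 : B X2 X2 = 0 by rewrite X2E !E u22 mulr0.
have X21 : B X2 X1 = 0 by rewrite BC.
have [Y1 Y1E] : exists Y, Y = B X2 y2 *: y1 - B X2 y1 *: y2 by eexists.
have [Y2 Y2E] : exists Y, Y = B X1 y1 *: y2 - B X1 y2 *: y1 by eexists.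
have XY11 : B X1 Y1 = D by rewrite Y1E !E DE; ring.
have XY21 : B X2 Y1 = 0 by rewrite Y1E !E; ring.
have XY12 : B X1 Y2 = 0 by rewrite Y2E !E; ring.
have XY22 : B X2 Y2 = D by rewrite Y2E !E DE; ring.
have [YX11 YX12] : B Y1 X1 = D /\ B Y1 X2 = 0 by split; rewrite BC.
have [YX21 YX22] : B Y2 X1 = 0 /\ B Y2 X2 = D by split; rewrite BC.
have S := (X11, X12, X22, X21, XY11, XY21, XY12, XY22, YX11, YX12, YX21, YX22).
have [Z1 Z1E] : exists Z, Z = D *: Y1 - (h * B Y1 Y1) *: X1 by eexists.
have [Z2 Z2E] : exists Z, Z = D *: Y2 - (h * B Y2 Y2) *: X2 by eexists.
have Z11 : B Z1 Z1 = 0.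
  rewrite Z1E !E !S.
  by apply: (eq_mod_half half (X := - (D ^+ 2 * B Y1 Y1))); ring.
have Z22 : B Z2 Z2 = 0.
  rewrite Z2E !E !S.
  by apply: (eq_mod_half half (X := - (D ^+ 2 * B Y2 Y2))); ring.
have XZ11 : B X1 Z1 = D ^+ 2 by rewrite Z1E !E !S; ring.
have XZ21 : B X2 Z1 = 0 by rewrite Z1E !E !S; ring.
have XZ12 : B X1 Z2 = 0 by rewrite Z2E !E !S; ring.
have XZ22 : B X2 Z2 = D ^+ 2 by rewrite Z2E !E !S; ring.
have [ZX11 ZX12] : B Z1 X1 = D ^+ 2 /\ B Z1 X2 = 0 by split; rewrite BC.
have [ZX21 ZX22] : B Z2 X1 = 0 /\ B Z2 X2 = D ^+ 2 by split; rewrite BC.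
exists (D ^+ 2), (D ^+ 4), X1, Z1, X2, (D ^+ 2 *: Z2 - B Z1 Z2 *: X1).
have mX k : ~ m (D ^+ k).
  elim: k => [|k IH]; first exact: (prime_ideal_proper prm).
  by rewrite exprS; apply: mMn.
split=> //; split=> //;
  by rewrite !E ?(S, Z11, Z22, XZ11, XZ21, XZ12, XZ22, ZX11, ZX12, ZX21, ZX22); ring.
Qed.

End LocalHyperbolicPairs.
(** * The transvection groups *)

Section GeneratedGroup.
Variables (R : comPzRingType) (M : lmodType R) (S : (M -> M) -> Prop).

Lemma genGroup_comp f g : genGroup S f -> genGroup S g -> genGroup S (f \o g).
Proof.
move=> Sf Sg; elim: Sf => [//|s f' Ss _ IH|s k f' Ss sk ks _ IH].
  exact: (gen_mul Ss IH).
exact: (gen_inv Ss sk ks IH).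
Qed.

Lemma inGroup_gen f : S f -> inGroup S f.
Proof. by move=> Sf; exists (f \o id); split=> //; apply: gen_mul => //; apply: gen_id. Qed.

Lemma inGroup_min (G : (M -> M) -> Prop) f : subgroup G ->
  (forall s, S s -> G s) -> inGroup S f -> G f.
Proof.
move=> sG SG [g [Sg fg]]; apply: (sg_ext sG (f := g)) => // {fg}.
elim: Sg => [|s g' Ss _ Gg'|s k g' Ss sk ks _ Gg']; first exact: sg_id.
  by apply: (sg_comp sG) => //; apply: SG.
by apply: (sg_comp sG) => //; apply: (sg_inv sG (SG s Ss)).
Qed.

Hypothesis invS : forall s, S s -> exists k, cancel s k /\ cancel k s.

Lemma inGroup_subgroup : subgroup (inGroup S).
Proof.
split=> [f g fg [k [Sk fk]]||f g [f1 [Sf1 ff1]] [g1 [Sg1 gg1]]|f f' [g [Sg fg]] fK f'K].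
- by exists k; split=> // x; rewrite -fg.
- by exists id; split=> //; apply: gen_id.
- exists (f1 \o g1); split; first exact: genGroup_comp.
  by move=> x /=; rewrite ff1 gg1.
have [g' [Sg' [gK g'K]]] : exists g', genGroup S g' /\ (cancel g g' /\ cancel g' g).
  elim: {f f' fK f'K fg} Sg => [|s g' Ss _ [k [Sk [gk kg]]]|s t g' Ss st ts _ [k [Sk [gk kg]]]].
  - by exists id; split=> //; apply: gen_id.
  - have [t [st ts]] := invS Ss.
    exists (k \o (t \o id)); split.
      by apply: genGroup_comp => //; apply: gen_inv Ss st ts _; apply: gen_id.
    by split=> x /=; rewrite ?st ?gk ?kg ?ts.
  exists (k \o (s \o id)); split.
    by apply: genGroup_comp => //; apply: gen_mul => //; apply: gen_id.
  by split=> x /=; rewrite ?ts ?gk ?kg ?st.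
exists g'; split=> // x; rewrite -[in RHS](f'K x) fg gK.
by [].
Qed.

End GeneratedGroup.

(** Lets stability under conjugation be checked on generators, through [inGroup_min]. *)
Lemma subgroup_conj (T : Type) (G : (T -> T) -> Prop) (g g' : T -> T) :
  subgroup G -> cancel g g' -> cancel g' g -> subgroup (fun k => G (g \o k \o g')).
Proof.
move=> sG gK g'K; split=> [k l kl Gk||k l Gk Gl|k k' Gk kK k'K].
- by apply: (sg_ext sG _ Gk) => x /=; rewrite kl.
- by apply: (sg_ext sG _ (sg_id sG)) => x /=; rewrite g'K.
- by apply: (sg_ext sG _ (sg_comp sG Gk Gl)) => x /=; rewrite gK.
by apply: (sg_inv sG Gk) => x /=; rewrite ?gK ?kK ?k'K.
Qed.

(** * Isotropic vectors and the elementary groups of [Q] *)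

Section IsotropicSpan.
Variables (R : comPzRingType) (P : lmodType R) (B : P -> P -> R) (h : R) (n : nat).
Hypotheses (half : 2%:R * h = 1) (orthB : orthogonal_module B).
Hypotheses (rk : has_rank P (2 * n)) (n2 : (2 <= n)%N) (spl : locally_split B).

Lemma hyperbolic_pairs_at m : maximal_ideal m -> exists d1 d2 x1 y1 x2 y2,
  [/\ ~ m d1, ~ m d2 & hyperbolic_pairs B d1 d2 x1 y1 x2 y2].
Proof.
(* As [n] is at least 2, the rank has the form [r.+3] required for the local construction. *)
move=> mm; have := rk mm; have -> : (2 * n = (2 * n - 3).+3)%N.
  by case: n n2 => [|[|k]] // _; rewrite !mulnS.
move=> rkm; exact: (local_hyperbolic_pairs orthB (maximal_prime mm) half rkm (spl mm)).
Qed.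

(** Isotropic vectors generate [P] additively: the scalars [l] with [K] true on all multiples of
    [l *: x] form an ideal, which contains [d1 * d2 ^+ 2] by [hyperbolic_pairs_span]. *)
Lemma isotropic_ind (K : P -> Prop) : K 0 -> (forall x y, K x -> K y -> K (x + y)) ->
  (forall x, B x x = 0 -> K x) -> forall x, K x.
Proof.
move=> K0 KD Kiso x; have [_ [bilB [ndB _]]] := orthB.
pose J l := forall r, K ((r * l) *: x).
suff J1 : J 1 by have := J1 1; rewrite mulr1 scale1r.
apply: ideal_local_global => [|m mm].
  split; first by move=> r; rewrite mulr0 scale0r.
  split=> [k l Jk Jl r|s k Jk r].
    by rewrite mulrDr scalerDl; apply: KD.
  by rewrite mulrA; apply: Jk.
have [d1 [d2 [x1 [y1 [x2 [y2 [md1 md2 hyp]]]]]]] := hyperbolic_pairs_at mm.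
have prm := maximal_prime mm.
exists (d1 * d2 ^+ 2); split.
  by rewrite expr2; do !apply: (prime_idealM prm).
move=> r; rewrite mulrC -scalerA.
apply: (hyperbolic_pairs_span bilB half ndB (V := fun=> True) (K := K) hyp) => //.
- by move=> *; apply: KD.
- by move=> l; apply: Kiso; rewrite !(bformE bilB) (hp_x1x1 hyp) !mulr0.
- by move=> l; apply: Kiso; rewrite !(bformE bilB) (hp_y1y1 hyp) !mulr0.
- by move=> z _ zz _ _; apply: Kiso.
Qed.

Let bilB : sym_bilinear B := proj1 (proj2 orthB).
Let ndB : forall p, (forall q, B p q = 0) -> p = 0 := proj1 (proj2 (proj2 orthB)).
Local Notation C := (Qform B).

Lemma Qform_bilinear : sym_bilinear C.
Proof.
split=> [x y|y a x z]; rewrite /Qform; first by rewrite (bformC bilB); ring.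
rewrite /= !(bformE bilB) /GRing.scale /=.
by ring.
Qed.

Lemma Qform_nondegenerate x : (forall y, C x y = 0) -> x = 0.
Proof.
move=> x0; case: x x0 => -[a b] p x0.
have -> : a = 0.
  by have := x0 ((0, 1), 0); rewrite /Qform /= (bform0r bilB) mulr1 mul0r !addr0.
have -> : b = 0.
  by have := x0 ((1, 0), 0); rewrite /Qform /= (bform0r bilB) mulr0 mul1r add0r addr0.
suff -> : p = 0 by [].
apply: ndB => q; have := x0 ((0, 0), q).
by rewrite /Qform /= !mulr0 !mul0r !add0r.
Qed.

Let e : Qmod P := ((1, 0), 0).
Let f : Qmod P := ((0, 1), 0).
Definition inQ (p : P) : Qmod P := ((0, 0), p).

Lemma Qee : C e e = 0.
Proof. by rewrite /Qform /= (bform0r bilB) !mulr0 !addr0. Qed.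
Lemma Qff : C f f = 0.
Proof. by rewrite /Qform /= (bform0r bilB) !mul0r !addr0. Qed.
Lemma Qef : C e f = 1.
Proof. by rewrite /Qform /= (bform0r bilB) mul0r mulr1 !addr0. Qed.
Lemma QinQ p q : C (inQ p) (inQ q) = B p q.
Proof. by rewrite /Qform /= !mul0r !add0r. Qed.
Lemma inQD p q : inQ (p + q) = inQ p + inQ q.
Proof.
have -> : inQ p + inQ q = ((0 + 0, 0 + 0), p + q) by [].
by rewrite !addr0.
Qed.
Lemma inQ_perp p : perp_ef C e f (inQ p).
Proof. by split; rewrite /Qform /= (bform0l bilB) !mulr0 ?mul0r !addr0. Qed.

Lemma perp_efP x : perp_ef C e f x -> x = inQ x.2.
Proof.
case: x => -[a b] p []; rewrite /Qform /= !(bform0l bilB) !mul0r !mul1r !mulr0 !mulr1.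
by rewrite !addr0 !add0r => -> ->.
Qed.

Local Notation E := (eichler C h).

Lemma rhoE q : B q q = 0 -> rho B q =1 E f (inQ q).
Proof.
move=> qq x; apply: (form_ext Qform_bilinear Qform_nondegenerate) => t.
rewrite /eichler QinQ qq mulr0 mul0r scale0r subr0 /Qform /=.
rewrite !(bformE bilB) /GRing.scale /= (bformC bilB q x.2) (bformC bilB q t.2).
by ring.
Qed.

Lemma muE q : B q q = 0 -> mu B q =1 E e (inQ q).
Proof.
move=> qq x; apply: (form_ext Qform_bilinear Qform_nondegenerate) => t.
rewrite /eichler QinQ qq mulr0 mul0r scale0r subr0 /Qform /=.
rewrite !(bformE bilB) /GRing.scale /= (bformC bilB q x.2) (bformC bilB q t.2).
by ring.
Qed.

Let bilC := Qform_bilinear.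
Let ndC := Qform_nondegenerate.

Lemma elem_gen_eichler J g : elem_gen B J g ->
  exists k q, [/\ k = e \/ k = f, B q q = 0, J q & g =1 E k (inQ q)].
Proof.
move=> [q [qq [Jq [gE|gE]]]].
  by exists f, q; split=> //; [right|move=> x; rewrite gE rhoE].
by exists e, q; split=> //; [left|move=> x; rewrite gE muE].
Qed.

Lemma eichler_can u v : C u u = 0 -> C u v = 0 ->
  cancel (E u v) (E u (- v)) /\ cancel (E u (- v)) (E u v).
Proof. by move=> uu uv; split; [apply: eichlerK|apply: eichlerVK]. Qed.

Lemma inQ_orth k q : k = e \/ k = f -> C k k = 0 /\ C k (inQ q) = 0.
Proof. by have [ep fp] := inQ_perp q; case=> ->; rewrite ?Qee ?Qff. Qed.

Lemma elem_gen_inv J g : elem_gen B J g -> exists k, cancel g k /\ cancel k g.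
Proof.
move=> /elem_gen_eichler[k [q [/(inQ_orth q)[kk kq] _ _ gE]]].
have [K1 K2] := eichler_can kk kq.
by exists (E k (- inQ q)); split=> x; rewrite gE ?K1 ?K2.
Qed.

Lemma elem_subgroup J : subgroup (inGroup (elem_gen B J)).
Proof. exact/inGroup_subgroup/elem_gen_inv. Qed.

Variable I : R -> Prop.
Hypothesis idI : ideal I.

Lemma ETransO_I_sub g : ETransO_I B I g -> ETransO B g.
Proof.
apply: (inGroup_min (elem_subgroup (fun=> True))) => s [q [qq [_ sE]]].
by apply: inGroup_gen; exists q.
Qed.

Definition linear_isometry (g : Qmod P -> Qmod P) : Prop :=
  [/\ is_linear g, forall x y, C (g x) (g y) = C x y &
      exists k, cancel g k /\ cancel k g].

Lemma linear_isometry_subgroup : subgroup linear_isometry.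
Proof.
split=> [g k gk [lg ig [g' [gK g'K]]]||g k [lg ig [g' [gK g'K]]] [lk ik [k' [kK k'K]]]|].
- split=> [a x y|x y|]; rewrite -?gk //.
  by exists g'; split=> x; rewrite -gk.
- by split=> //; exists id.
- split=> [a x y|x y|] /=; [by rewrite lk lg|by rewrite ig|].
  by exists (k' \o g'); split=> x /=; rewrite ?gK ?kK ?k'K ?g'K.
move=> g g' [lg ig _] gK g'K; split=> [a x y|x y|]; last by exists g.
  by apply: (can_inj gK); rewrite lg !g'K.
by rewrite -ig !g'K.
Qed.

Lemma ETransO_linear_isometry g : ETransO B g -> linear_isometry g.
Proof.
apply: (inGroup_min linear_isometry_subgroup) => s /elem_gen_eichler[k [q]].
move=> [/(inQ_orth q)[kk kq] _ _ sE].
apply: (sg_ext linear_isometry_subgroup (f := E k (inQ q))) => [x|]; first by rewrite sE.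
split; first exact: eichler_linear; last first.
  by exists (E k (- inQ q)); apply: eichler_can.
by move=> x y; apply: eichler_isometry.
Qed.

Lemma conj_gen_inv g : conj_gen B I g -> exists k, cancel g k /\ cancel k g.
Proof.
move=> [k [k' [l [Gk [kK [k'K [Gl gE]]]]]]].
have [_ _ [l' [lK l'K]]] := ETransO_linear_isometry (ETransO_I_sub Gl).
by exists (k \o l' \o k'); split=> x; rewrite /= gE /= ?kK ?k'K ?lK ?l'K.
Qed.

Lemma ETransO_rel_subgroup : subgroup (ETransO_rel B I).
Proof. exact/inGroup_subgroup/conj_gen_inv. Qed.

Lemma ETransO_I_rel g : ETransO_I B I g -> ETransO_rel B I g.
Proof.
move=> Gg; apply: inGroup_gen; exists id, id, g; split=> //.
exact: sg_id (elem_subgroup _).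
Qed.

Lemma eichler_additive_subgroup G k : subgroup G -> k = e \/ k = f ->
  G (E k (inQ 0)) /\
  (forall p q, G (E k (inQ p)) -> G (E k (inQ q)) -> G (E k (inQ (p + q)))).
Proof.
move=> sG ke; split=> [|p q Gp Gq].
  by apply: (sg_ext sG _ (sg_id sG)) => x; rewrite -[inQ 0]/(0 : Qmod P) eichler0.
apply: (sg_ext sG _ (sg_comp sG Gp Gq)) => x /=.
have [kk kp] := inQ_orth p ke; have [_ kq] := inQ_orth q ke.
by rewrite inQD eichlerD.
Qed.

Lemma eichler_inQ_gen k p (J : P -> Prop) : k = e \/ k = f -> B p p = 0 -> J p ->
  inGroup (elem_gen B J) (E k (inQ p)).
Proof.
move=> ke pp Jp; apply: inGroup_gen; exists p; split=> //; split=> //.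
by case: ke => ->; [right|left] => x; rewrite ?muE ?rhoE.
Qed.

(** For isotropic [p] this is a generator [rho] or [mu]; additivity in [p] extends it to all of
    [P]. *)
Lemma ETransO_eichler k p : k = e \/ k = f -> ETransO B (E k (inQ p)).
Proof.
move=> ke; have [G0 GD] := eichler_additive_subgroup (elem_subgroup (fun=> True)) ke.
move: p; apply: (isotropic_ind G0 GD) => p pp.
exact: eichler_inQ_gen.
Qed.

Lemma ETransO_I_eichler k p : k = e \/ k = f -> inIM I p -> ETransO_I B I (E k (inQ p)).
Proof.
move=> ke [l [a [q [Ia ->]]]].
have [G0 GD] := eichler_additive_subgroup (elem_subgroup (inIM I)) ke.
apply: (big_ind (fun p => ETransO_I B I (E k (inQ p)))) => // i _.
(* The coefficient [a i] stays outside the induction, so that each isotropic summand remains in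
   [IP]. *)
pose K q := ETransO_I B I (E k (inQ (a i *: q))).
apply: (@isotropic_ind K); rewrite /K.
- by rewrite scaler0.
- by move=> x y Kx Ky; rewrite scalerDr; apply: GD.
- move=> x xx; apply: eichler_inQ_gen => //; last exact: inIM_scale.
  by rewrite !(bformE bilB) xx !mulr0.
Qed.

Lemma ETransO_elementary_pair :
  elementary_pair C h e f I (ETransO B) (ETransO_rel B I).
Proof.
split.
- exact: elem_subgroup.
- exact: ETransO_rel_subgroup.
- move=> g; apply: (inGroup_min (elem_subgroup (fun=> True))).
  move=> s [k [k' [l [Gk [kK [k'K [Gl sE]]]]]]].
  have sG := elem_subgroup (fun=> True).
  apply: (sg_ext sG (f := k \o l \o k')); first by move=> x; rewrite sE.
  apply: (sg_comp sG); last first.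
    by have := sg_inv sG Gk kK k'K.
  by apply: (sg_comp sG) => //; apply: ETransO_I_sub.
- move=> g g' k Gg gK g'K.
  apply: (inGroup_min (subgroup_conj ETransO_rel_subgroup gK g'K)).
  move=> s [l [l' [t [Gl [lK [l'K [Gt sE]]]]]]].
  apply: inGroup_gen; exists (g \o l), (l' \o g'), t.
  split; first exact: (sg_comp (elem_subgroup (fun=> True)) Gg Gl).
  split; first by move=> x /=; rewrite gK lK.
  split; first by move=> x /=; rewrite l'K g'K.
  by split=> // x /=; rewrite sE.
- by move=> p /perp_efP ->; split; apply: ETransO_eichler; [left|right].
move=> p /perp_efP pE Ip.
have Ip2 : inIM I p.2 by apply: (inIM_linear (g := snd)) Ip.
by rewrite pE; split; apply/ETransO_I_rel/ETransO_I_eichler => //; [left|right].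
Qed.

(** * The two inclusions *)

Lemma unimodular_pairing (u : Qmod P) : unimodular u -> exists w, C u w = 1.
Proof.
move=> [phi [lphi phiu]].
have phi0 : phi 0 = 0.
  have := lphi 1 0 0; rewrite scaler0 add0r scale1r => /esym E0.
  by apply: (addrI (phi 0)); rewrite E0 addr0.
have [|r rE] := proj2 (proj2 (proj2 orthB)) (phi \o inQ).
  move=> a x y /=; rewrite -lphi; congr phi.
  have -> : a *: inQ x + inQ y = ((a * 0 + 0, a * 0 + 0), a *: x + y) by [].
  by rewrite !mulr0 !addr0.
(* The two values are exchanged because [e] pairs with [f]. *)
exists ((phi f, phi e), r); rewrite -phiu.
have uE : u = u.1.1 *: e + (u.1.2 *: f + inQ u.2).
  apply: (form_ext bilC ndC) => t; rewrite !(bformE bilC) /Qform /=.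
  by rewrite !(bform0l bilB); ring.
rewrite [in RHS]uE !lphi (rE u.2 : phi (inQ u.2) = _) /Qform /= (bformC bilB r).
by rewrite /GRing.scale /=; ring.
Qed.

Lemma otransvectionE u v : C v v = 0 -> otransvection C u v =1 E u v.
Proof. by move=> vv x; rewrite /eichler vv mulr0 mul0r scale0r subr0. Qed.

Lemma eichler_ETransO_rel u v : C u u = 0 -> C u v = 0 -> unimodular u ->
  inIM I u \/ inIM I v -> ETransO_rel B I (E u v).
Proof.
move=> uu uv uni Iuv; have [w uw] := unimodular_pairing uni.
(* If [u] lies in [IQ], then [1 = C u w] lies in [I], so [v] lies in [IQ] too. *)
have Iv : inIM I v.
  case: Iuv => // Iu; rewrite -[v]scale1r -uw; apply: inIM_scale.
  exact: inIM_form Iu.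
apply: (eichler_in bilC half ndC Qee Qff Qef ETransO_elementary_pair idI) => //.
  move=> m /hyperbolic_pairs_at[d1 [d2 [x1 [y1 [x2 [y2 [md1 md2 hyp]]]]]]].
  exists d1, d2, (inQ x1), (inQ y1), (inQ x2), (inQ y2).
  split=> //; first by split; apply: inQ_perp.
  by case: hyp => *; split; rewrite QinQ.
by exists w.
Qed.

Lemma TransO_ETransO_rel g : TransO_Q B I g -> ETransO_rel B I g.
Proof.
apply: (inGroup_min ETransO_rel_subgroup) => s [u [v [uu [vv [uv [uni [Iuv sE]]]]]]].
apply: (sg_ext ETransO_rel_subgroup (f := E u v)).
  by move=> x; rewrite sE otransvectionE.
case: uni => uni; first exact: eichler_ETransO_rel.
(* When [v] is the unimodular vector, [eichler_swap] makes it the first argument. *)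
apply: (sg_ext ETransO_rel_subgroup (f := E v (- u))).
  by move=> x; rewrite [RHS]eichler_swap.
have vu : C v u = 0 by rewrite (bformC bilC).
apply: eichler_ETransO_rel => //; first by rewrite (bformE bilC) vu oppr0.
by case: Iuv => ?; [right; apply: inIMN|left].
Qed.

Lemma otrans_inv g : is_otrans_rel C I g -> exists k, cancel g k /\ cancel k g.
Proof.
move=> [u [v [uu [vv [uv [_ [_ gE]]]]]]].
have [K1 K2] := eichler_can uu uv.
by exists (E u (- v)); split=> x; rewrite gE otransvectionE // ?K1 ?K2.
Qed.

Lemma TransO_subgroup : subgroup (TransO_Q B I).
Proof. exact/inGroup_subgroup/otrans_inv. Qed.

(** Conjugating [E(z, q)] by the isometry [k] gives [E(k z, k q)]. Here [k z] is unimodular because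
    it pairs to 1 with the image of the other hyperbolic basis vector, and [k q] stays in [IQ]. *)
Lemma ETransO_rel_TransO g : ETransO_rel B I g -> TransO_Q B I g.
Proof.
apply: (inGroup_min TransO_subgroup) => s [k [k' [l [Gk [kK [k'K [Gl sE]]]]]]].
apply: (sg_ext TransO_subgroup (f := k \o l \o k')); first by move=> x; rewrite sE.
apply: (inGroup_min (subgroup_conj TransO_subgroup kK k'K)) Gl => {s l sE} s.
move=> /elem_gen_eichler[z [q [ze qq Iq sE]]].
have [zz zq] := inQ_orth q ze.
have [lk ik _] := ETransO_linear_isometry Gk.
have qq' : C (inQ q) (inQ q) = 0 by rewrite QinQ.
apply: inGroup_gen; exists (k z), (k (inQ q)); rewrite !ik.
split=> //; split=> //; split=> //; split; last split.
- left; have [z' zz'] : exists z', C z z' = 1.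
    case: ze => ->; first by exists f; apply: Qef.
    by exists e; rewrite (bformC bilC) Qef.
  exists (fun x => C x (k z')); split; last by rewrite ik.
  by case: bilC.
- right; apply: inIM_linear => //.
  have lin : is_linear inQ.
    move=> a x y; have -> : a *: inQ x + inQ y = ((a * 0 + 0, a * 0 + 0), a *: x + y) by [].
    by rewrite !mulr0 !addr0.
  exact: inIM_linear.
move=> x /=; rewrite sE (eichler_conj bilC h ndC _ _ _ lk k'K ik) otransvectionE //.
by rewrite ik.
Qed.

End IsotropicSpan.

Theorem mainTheorem1 (R : comPzRingType) (I : R -> Prop) (P : lmodType R)
    (B : P -> P -> R) (n : nat) :
  (exists u : R, 2%:R * u = 1) ->
  ideal I ->
  orthogonal_module B ->
  has_rank P (2 * n) ->
  (2 <= n)%N ->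
  locally_split B ->
  forall f : Qmod P -> Qmod P, TransO_Q B I f <-> ETransO_rel B I f.
Proof.
move=> [h half] idI orthB rk n2 spl f; split.
  exact: (TransO_ETransO_rel half orthB rk n2 spl idI).
exact: (ETransO_rel_TransO half orthB).
Qed.
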